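(* Up to isomorphism, there are exactly $5$ classes of locally equienergetic graphs of order $7$, namely the following sets (all members of each set having equal local energy $e$): (i) $\{K_7,\ K_5\cup K_2,\ K_4\cup K_3,\ K_3\cup K_2\cup K_2,\ C_7,\ C_5\cup K_2\}$; (ii) $\{K_6\cup K_1,\ K_4\cup K_2\cup K_1,\ K_3\cup K_3\cup K_1,\ K_2\cup K_2\cup K_2\cup K_1\}$; (iii) $\{K_5\cup K_1\cup K_1,\ K_3\cup K_2\cup K_1\cup K_1,\ C_5\cup K_1\cup K_1\}$; (iv) $\{K_4\cup K_1\cup K_1\cup K_1,\ K_2\cup K_2\cup K_1\cup K_1\cup K_1\}$; (v) $\{K_4\cup P_3,\ K_2\cup K_2\cup P_3\}$.
   Context: For a finite simple undirected graph $G$ with vertices $v_1,\dots,v_n$, the adjacency matrix $A(G)$ has $(i,j)$ entry $1$ if $v_i,v_j$ are adjacent and $0$ otherwise. The energy $\mathscr{E}(G)$ is the sum of the absolute values of the eigenvalues of $A(G)$ (counted with multiplicity); the graph with no vertices has energy $0$. For a vertex $v$ of $G$, let $G^{v}$ be the graph obtained from $G$ by deleting $v$. The local energy of $G$ at $v$ is $\mathscr{E}_G(v)=\mathscr{E}(G)-\mathscr{E}(G^{v})$, and the local energy of $G$ is $e(G)=\sum_{v\in V(G)}\mathscr{E}_G(v)$. Two (non-isomorphic) graphs of the same order are locally equienergetic if they have the same local energy. A class of locally equienergetic graphs of order $n$ is the set of all isomorphism classes of finite simple undirected (possibly disconnected) graphs of order $n$ having a given common value of $e$, provided this set has at least two elements.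 $K_m$, $C_m$, $P_m$ are the complete graph, the cycle and the path on $m$ vertices; $\cup$ is disjoint union. *)

(* Defs.v *)
From HB Require Import structures.
From mathcomp Require Import all_boot all_order all_algebra perm algC.

Set Implicit Arguments.
Unset Strict Implicit.
Unset Printing Implicit Defensive.

Import GRing.Theory.
Local Open Scope ring_scope.

(* A graph of order n is a labelled simple graph on 'I_n: sgraph n is a finite
   type whose equality is equality of labelled graphs, not isomorphism. *)

Definition simple_rel n (e : {ffun 'I_n * 'I_n -> bool}) : bool :=
  [forall x, forall y, e (x, y) == e (y, x)] && [forall x, ~~ e (x, x)].

Record sgraph n := SGraph {
  adj_ffun : {ffun 'I_n * 'I_n -> bool};
  _ : simple_rel adj_ffun }.

HB.instance Definition _ n := [isSub for @adj_ffun n].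
HB.instance Definition _ n := [Finite of sgraph n by <:].

Definition adj n (G : sgraph n) : rel 'I_n := fun x y => adj_ffun G (x, y).

Lemma adj_sym n (G : sgraph n) : symmetric (adj G).
Proof.
have /andP[/forallP es _] := valP G.
by move=> x y; apply/eqP/(forallP (es x)).
Qed.

Lemma adj_irr n (G : sgraph n) : irreflexive (adj G).
Proof. by have /andP[_ /forallP ei] := valP G => x; apply/negbTE/ei. Qed.

Lemma simple_relP n (e : rel 'I_n) :
  symmetric e -> irreflexive e -> simple_rel [ffun p => e p.1 p.2].
Proof.
move=> es ei; apply/andP; split; apply/forallP => x; last by rewrite ffunE /= ei.
by apply/forallP => y; rewrite !ffunE /= es.
Qed.

Definition mk_graph n (e : rel 'I_n) (es : symmetric e) (ei : irreflexive e) :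
  sgraph n := SGraph (simple_relP es ei).

Lemma adj_mk n (e : rel 'I_n) (es : symmetric e) (ei : irreflexive e) :
  adj (mk_graph es ei) =2 e.
Proof. by move=> x y; rewrite /adj ffunE. Qed.

(* [lift v] is the increasing bijection from 'I_n.-1 onto 'I_n minus v. *)
Definition del_rel n (G : sgraph n) (v : 'I_n) : rel 'I_n.-1 :=
  fun x y => adj G (lift v x) (lift v y).
Fact del_sym n (G : sgraph n) v : symmetric (del_rel G v).
Proof. by move=> x y; apply: adj_sym. Qed.
Fact del_irr n (G : sgraph n) v : irreflexive (del_rel G v).
Proof. by move=> x; apply: adj_irr. Qed.
Definition del_vertex n (G : sgraph n) (v : 'I_n) : sgraph n.-1 :=
  mk_graph (@del_sym n G v) (@del_irr n G v).

Definition union_rel m n (G : sgraph m) (H : sgraph n) : rel 'I_(m + n) :=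
  fun x y => match split x, split y with
             | inl a, inl b => adj G a b
             | inr a, inr b => adj H a b
             | _, _ => false
             end.
Fact union_sym m n (G : sgraph m) (H : sgraph n) : symmetric (union_rel G H).
Proof.
rewrite /union_rel => x y.
by case: (split x) => a; case: (split y) => b //; apply: adj_sym.
Qed.
Fact union_irr m n (G : sgraph m) (H : sgraph n) : irreflexive (union_rel G H).
Proof. by rewrite /union_rel => x; case: (split x) => a; apply: adj_irr. Qed.
Definition disj_union m n (G : sgraph m) (H : sgraph n) : sgraph (m + n) :=
  mk_graph (@union_sym m n G H) (@union_irr m n G H).

Definition complete_rel n : rel 'I_n := fun x y => x != y.
Fact complete_sym n : symmetric (@complete_rel n).
Proof. by move=> x y; rewrite /complete_rel eq_sym. Qed.
Fact complete_irr n : irreflexive (@complete_rel n).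
Proof. by move=> x; rewrite /complete_rel eqxx. Qed.
Definition K_ n : sgraph n := mk_graph (@complete_sym n) (@complete_irr n).

(* K_2 for n = 2: the usual C_n only when n >= 3. *)
Definition cycle_rel n : rel 'I_n := fun x y =>
  (x != y) && ((x.+1 %% n == y)%N || (y.+1 %% n == x)%N).
Fact cycle_sym n : symmetric (@cycle_rel n).
Proof. by move=> x y; rewrite /cycle_rel eq_sym orbC. Qed.
Fact cycle_irr n : irreflexive (@cycle_rel n).
Proof. by move=> x; rewrite /cycle_rel eqxx. Qed.
Definition C_ n : sgraph n := mk_graph (@cycle_sym n) (@cycle_irr n).

Definition path_rel n : rel 'I_n := fun x y =>
  (x.+1 == y :> nat) || (y.+1 == x :> nat).
Fact path_sym n : symmetric (@path_rel n).
Proof. by move=> x y; apply: orbC. Qed.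
Fact path_irr n : irreflexive (@path_rel n).
Proof. by move=> x; rewrite /path_rel orbb gtn_eqF. Qed.
Definition P_ n : sgraph n := mk_graph (@path_sym n) (@path_irr n).

Definition iso n (G H : sgraph n) : bool :=
  [exists s : 'S_n, [forall x, forall y, adj H (s x) (s y) == adj G x y]].

Definition iso_class n (G : sgraph n) : {set sgraph n} := [set H | iso G H].

Definition adj_mx n (G : sgraph n) : 'M[algC]_n := \matrix_(x, y) (adj G x y)%:R.

(* The roots of the characteristic polynomial, repeated according to their
   multiplicities (see eigenvaluesP). *)
Definition eigenvalues n (A : 'M[algC]_n) : seq algC :=
  sval (closed_field_poly_normal (char_poly A)).

Lemma eigenvaluesP n (A : 'M[algC]_n) :
  char_poly A = \prod_(x <- eigenvalues A) ('X - x%:P).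
Proof.
rewrite /eigenvalues; case: closed_field_poly_normal => s /= {1}->.
by rewrite (monicP (char_poly_monic A)) scale1r.
Qed.

Definition energy n (G : sgraph n) : algC :=
  \sum_(x <- eigenvalues (adj_mx G)) `|x|.

Definition local_energy_at n (G : sgraph n) (v : 'I_n) : algC :=
  energy G - energy (del_vertex G v).

Definition local_energy n (G : sgraph n) : algC :=
  \sum_(v < n) local_energy_at G v.

Definition iso_classes_of_local_energy n (a : algC) : {set {set sgraph n}} :=
  [set iso_class G | G : sgraph n & local_energy G == a].

(* It suffices to let the common value range over the values attained by the
   local energy: any other value gives the empty set of isomorphism classes. *)
Definition equienergetic_classes n : {set {set {set sgraph n}}} :=
  [set S in [set iso_classes_of_local_energy n (local_energy G) | G : sgraph n]
   | (1 < #|S|)%N].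

Definition iso_classes_of n (s : seq (sgraph n)) : {set {set sgraph n}} :=
  [set iso_class G | G in s].

Declare Scope sgraph_scope.
Delimit Scope sgraph_scope with G.
Bind Scope sgraph_scope with sgraph.
Notation "G ∪ H" := (disj_union G H)
  (at level 50, left associativity) : sgraph_scope.

(* Main.v *)
From Stdlib Require Import ZArith.
Require Import Defs.
From mathcomp Require Import all_boot all_order all_algebra perm algC ssrZ zify.

(** The local energy of a graph [G] of order 7 is [7 E(G) - sum_v E(G - v)].
It is an isomorphism invariant, and there are 1044 graphs of order 7 up to
isomorphism, so the theorem is about 1044 real numbers: seventeen of them form
the five coincidences of the statement, and the resulting 1032 values are
distinct.

The coincidences have a simple cause. Local energy is additive over disjoint
unions; it is [2 m] on [K_m] for [m >= 2], [0] on [K_1], [10] on [C_5] and [14]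
on [C_7]. In the proof each of the seventeen values is computed exactly: the
characteristic polynomials involved split into linear factors, three further
polynomials and their mirror images [q(-x)], and energy is additive over
products of polynomials, so local energies become integer combinations of the
energies of four polynomials ([local_energy_vectorP]).

The distinctness of the other values is numerical, and delicate, because the
two closest values differ by less than [10^-5]. It rests on three ingredients.
Every graph of order [n + 1] is a one-vertex extension of a representative of
order [n], which yields a list of representatives ([levelP]). Characteristic
polynomials are computed over the integers by bordering the adjacency matrix
([charpolyzP]). Finally, adjacency eigenvalues are real, so [d] sign changes of
a factor of degree [d] locate each of its roots, and rational bounds on the
energy follow ([energy_boundsP]). The representatives come out grouped into
intervals that are pairwise disjoint ([separated_inj]), and every group with
more than one member consists of named graphs ([group_cases]).

The factorizations, the points of sign change, the groups and the canonical
labellings come from search functions, and it is their results that are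
verified. The graphs named in the statement are
pairwise non-isomorphic because their characteristic polynomials differ
([named_iso]). *)

Set Implicit Arguments.
Unset Strict Implicit.
Unset Printing Implicit Defensive.

Import Order.TTheory GRing.Theory Num.Theory.

(** * Isomorphism and induced subgraphs *)

Lemma sgraphP n (G H : sgraph n) : adj G =2 adj H -> G = H.
Proof. by move=> e; apply/val_inj/ffunP => -[x y]; apply: e. Qed.

Lemma isoP n (G H : sgraph n) :
  reflect (exists s : 'S_n, forall x y, adj H (s x) (s y) = adj G x y) (iso G H).
Proof.
apply: (iffP existsP) => -[s sP]; exists s.
  by move=> x y; apply/eqP; apply/forallP: y; apply/forallP: x.
by apply/forallP => x; apply/forallP => y; apply/eqP.
Qed.

Lemma iso_refl n (G : sgraph n) : iso G G.
Proof. by apply/isoP; exists 1%g => x y; rewrite !perm1. Qed.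

Lemma iso_sym n (G H : sgraph n) : iso G H -> iso H G.
Proof.
case/isoP=> s sP; apply/isoP; exists (s^-1)%g => x y.
by rewrite -sP !permKV.
Qed.

Lemma iso_trans n (G H I : sgraph n) : iso G H -> iso H I -> iso G I.
Proof.
case/isoP=> s sP /isoP[t tP]; apply/isoP; exists (s * t)%g => x y.
by rewrite !permM tP sP.
Qed.

Lemma iso_class_eq n (G H : sgraph n) : iso_class G = iso_class H <-> iso G H.
Proof.
split=> [/setP/(_ H)|GH]; first by rewrite !inE iso_refl.
apply/setP => I; rewrite !inE; apply/idP/idP; last exact: iso_trans.
exact/iso_trans/iso_sym.
Qed.

Section Induced.
Variables (m n : nat) (G : sgraph n) (f : 'I_m -> 'I_n).

Definition induced_rel : rel 'I_m := fun x y => adj G (f x) (f y).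
Fact induced_sym : symmetric induced_rel.
Proof. by move=> x y; apply: adj_sym. Qed.
Fact induced_irr : irreflexive induced_rel.
Proof. by move=> x; apply: adj_irr. Qed.
Definition induced : sgraph m := mk_graph induced_sym induced_irr.

Lemma adj_induced x y : adj induced x y = adj G (f x) (f y).
Proof. exact: adj_mk. Qed.

End Induced.

Lemma adj_del n (G : sgraph n) v x y :
  adj (del_vertex G v) x y = adj G (lift v x) (lift v y).
Proof. exact: adj_mk. Qed.

Lemma del_vertexE n (G : sgraph n) v : del_vertex G v = induced G (lift v).
Proof. by apply: sgraphP => x y; rewrite adj_del adj_induced. Qed.

(** Relabelling, deleting a vertex and extending a graph are all induced
subgraphs along some injection, so this one criterion yields every isomorphism
needed below: an induced subgraph only depends on the image. *)
Lemma iso_induced m n (G : sgraph n) (f g : 'I_m -> 'I_n) :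
  injective f -> (forall i, exists j, f i = g j) ->
  iso (induced G f) (induced G g).
Proof.
move=> fI fg.
have sP i : {j | f i == g j}.
  by apply: sigW; have [j ->] := fg i; exists j.
have sE i : g (sval (sP i)) = f i by case: (sP i) => j /= /eqP.
have sI : injective (fun i => sval (sP i)).
  by move=> i j ij; apply: fI; rewrite -!sE ij.
by apply/isoP; exists (perm sI) => x y; rewrite !adj_induced !permE !sE.
Qed.

Lemma iso_del n (G H : sgraph n.+1) (s : 'S_n.+1) v :
  (forall x y, adj H (s x) (s y) = adj G x y) ->
  iso (del_vertex G v) (del_vertex H (s v)).
Proof.
move=> sP; have -> : del_vertex G v = induced H (s \o lift v).
  by apply: sgraphP => x y; rewrite adj_del adj_induced /= sP.
rewrite del_vertexE; apply: iso_induced => [x y /perm_inj/lift_inj //|i].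
have: s (lift v i) != s v by rewrite (inj_eq perm_inj) eq_sym neq_lift.
by rewrite eq_sym => /unlift_some[j ej _]; exists j; rewrite /= ej.
Qed.

(** * Adjacency matrices as lists *)

Definition code := seq (seq bool).

Definition code_of n (G : sgraph n) : code :=
  [seq [seq adj G i j | j <- enum 'I_n] | i <- enum 'I_n].

Definition reindex (g : code) (p : seq nat) : code :=
  [seq [seq nth false r j | j <- p] | r <- [seq nth [::] g i | i <- p]].

Definition others n v := [seq i <- iota 0 n | ~~ eqn i v].

Definition extend (s : seq bool) (g : code) : code :=
  (false :: s) :: [seq x.1 :: x.2 | x <- zip s g].

Lemma nth_code n (G : sgraph n) (i j : 'I_n) :
  nth false (nth [::] (code_of G) i) j = adj G i j.
Proof.
by rewrite (nth_map i) ?size_enum_ord // (nth_map i) ?size_enum_ord // !nth_ord_enum.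
Qed.

Lemma code_induced m n (G : sgraph n) (f : 'I_m -> 'I_n) :
  code_of (induced G f) = reindex (code_of G) [seq val (f i) | i <- enum 'I_m].
Proof.
rewrite /reindex /code_of -2!map_comp; apply: eq_map => i /=.
by rewrite -map_comp; apply: eq_map => j /=; rewrite adj_induced nth_code.
Qed.

Lemma others_lift n (v : 'I_n.+1) :
  others n.+1 v = [seq val (lift v i) | i <- enum 'I_n].
Proof.
have -> : [seq val (lift v i) | i <- enum 'I_n] = map (bump v) (iota 0 n).
  by rewrite -val_enum_ord -map_comp.
have: v <= n by rewrite -ltnS.
move: (nat_of_ord v) => {}v lev.
rewrite /others -[n.+1](subnKC (leqW lev)) subSn // iotaD filter_cat.
rewrite -[in RHS](subnKC lev) iotaD map_cat !add0n /=; congr (_ ++ _).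
  rewrite (_ : [seq i <- _ | _] = iota 0 v).
    rewrite -[LHS]map_id; apply/eq_in_map => i; rewrite mem_iota /= add0n => iv.
    by rewrite /bump leqNgt iv.
  by apply/all_filterP/allP => i; rewrite mem_iota eqnE /= add0n => /ltn_eqF->.
rewrite eqnE eqxx /= (_ : [seq i <- _ | _] = iota v.+1 (n - v)).
  rewrite -add1n iotaDl; apply/eq_in_map => i.
  by rewrite mem_iota /bump => /andP[-> _].
by apply/all_filterP/allP => i; rewrite mem_iota neq_ltn orbC => /andP[->].
Qed.

Lemma code_del n (G : sgraph n.+1) v :
  code_of (del_vertex G v) = reindex (code_of G) (others n.+1 v).
Proof. by rewrite del_vertexE code_induced others_lift. Qed.

Lemma code_del0 n (G : sgraph n.+1) :
  code_of (del_vertex G ord0) = map behead (behead (code_of G)).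
Proof.
rewrite /code_of enum_ordSl /= -2!map_comp; apply: eq_map => i /=.
by rewrite -[RHS]map_comp; apply: eq_map => j; apply: adj_del.
Qed.

(** * Canonical forms *)

(** When [o] is duplicate-free this says that [p] is a permutation of [o]; it
only uses comparisons of natural numbers, so it is cheap to evaluate. *)
Definition arranges (o p : seq nat) :=
  eqn (size p) (size o) && all (fun i => has (eqn i) p) o.

Fixpoint lexcmp (u v : seq nat) : comparison :=
  match u, v with
  | [::], [::] => Eq
  | [::], _ => Lt
  | _, [::] => Gt
  | a :: u', b :: v' => if Nat.compare a b is Eq then lexcmp u' v' else Nat.compare a b
  end.

Definition nat_of_adj (g : code) (v u : nat) : nat := nth false (nth [::] g v) u.

(** One step of a search for the ordering of the vertices with the
lexicographically largest adjacency rows, each row being preceded by the degree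
of its vertex: among all one-vertex extensions of the partial orderings [ps]
(most recent vertex first), those with the largest last row are kept. *)
Definition best_extensions n (g : code) (deg : seq nat) (ps : seq (seq nat)) :=
  let cands := flatten [seq
    [seq (nth 0%N deg v :: map (nat_of_adj g v) p, v :: p)
    | v <- iota 0 n & ~~ has (eqn v) p] | p <- ps] in
  (foldr (fun c (best : seq nat * seq (seq nat)) =>
            match lexcmp c.1 best.1 with
            | Gt => (c.1, [:: c.2])
            | Eq => (best.1, c.2 :: best.2)
            | Lt => best
            end) ([::], [::]) cands).2.

Definition vertex_order n (g : code) : seq nat :=
  let deg := [seq sumn (map nat_of_bool r) | r <- g] in
  rev (head [::] (iter n (best_extensions n g deg) [:: [::]])).

(** The test makes [canon] sound, that is isomorphic to its argument, whatever
the search returns. A search that did not bring isomorphic graphs to the same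
form would lengthen the list of representatives, and be detected by the final
comparison of energies. *)
Definition canon n (g : code) : code :=
  let p := vertex_order n g in if arranges (iota 0 n) p then reindex g p else g.

Lemma arrangesP n p : arranges (iota 0 n) p ->
  exists2 f : 'I_n -> 'I_n, bijective f & p = [seq val (f i) | i <- enum 'I_n].
Proof.
rewrite /arranges eqnE size_iota => /andP[/eqP sp /allP ip].
have {}ip : {subset iota 0 n <= p}.
  by move=> i /ip /hasP[j jp] /eqP->.
have [|_ pE] := uniq_min_size (iota_uniq 0 n) ip; first by rewrite sp size_iota.
have pn (i : 'I_n) : nth 0%N p i < n.
  by have := mem_nth 0%N (n := i) (s := p); rewrite sp ltn_ord -pE mem_iota => /(_ isT).
have pU : uniq p by rewrite (uniq_size_uniq (iota_uniq 0 n) pE) sp size_iota.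
exists (fun i => Ordinal (pn i)).
  apply: injF_bij => i j [] /eqP; rewrite nth_uniq ?sp // => /eqP.
  exact: val_inj.
rewrite -{1}(mkseq_nth 0%N p) sp /mkseq -val_enum_ord -map_comp.
exact: eq_map.
Qed.

Lemma canonP n (G : sgraph n) :
  exists2 H, iso G H & code_of H = canon n (code_of G).
Proof.
rewrite /canon; case: ifP => [/arrangesP[f [h fK hK] ->] | _]; last first.
  by exists G => //; apply: iso_refl.
exists (induced G f); last exact: code_induced.
rewrite [X in iso X _](_ : G = induced G id); last first.
  by apply: sgraphP => x y; rewrite adj_induced.
by apply: iso_induced => [x y|i] //; exists (h i); rewrite hK.
Qed.

(** * Enumeration up to isomorphism *)

Fixpoint all_bools n : seq (seq bool) :=
  if n is n'.+1 then
    [seq true :: s | s <- all_bools n'] ++ [seq false :: s | s <- all_bools n']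
  else [:: [::]].

Lemma mem_all_bools n s : size s = n -> s \in all_bools n.
Proof.
elim: n s => [|n IHn] [|b s] //= [/IHn sn].
by rewrite mem_cat; case: b; rewrite map_f ?orbT.
Qed.

(** Tries indexed by bit strings make the searches among a thousand graphs
affordable. An entry also stores the graph itself, which [lookup] compares with
the one sought, so that a successful search is always correct. *)
Inductive trie (A : Type) := Tip | Node of option A & trie A & trie A.
Arguments Tip {A}.

Fixpoint tfind A (k : seq bool) (t : trie A) : option A :=
  if t is Node v l r then
    match k with
    | [::] => v
    | b :: k' => tfind k' (if b then l else r)
    end
  else None.

Fixpoint tadd A (k : seq bool) (x : A) (t : trie A) : trie A :=
  let: (v, l, r) := if t is Node v l r then (v, l, r) else (None, Tip, Tip) in
  match k with
  | [::] => Node (Some x) l r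
  | true :: k' => Node v (tadd k' x l) r
  | false :: k' => Node v l (tadd k' x r)
  end.

Lemma tfind_tadd A k k' x y (t : trie A) :
  tfind k (tadd k' x t) = Some y -> y = x \/ tfind k t = Some y.
Proof.
have tipE j : tfind j Tip = None :> option A by case: j.
elim: k' k t => [|b' k' IHk] k t.
  by case: t k => [|v l r] [|b k] //=; rewrite ?if_same ?tipE; auto; case=> <-; left.
case: t => [|v l r]; case: b' k => [] [|b k] //=; auto; case: b; auto; rewrite ?tipE //;
  by case/IHk; auto; rewrite tipE.
Qed.

Fixpoint eq_bits (u v : seq bool) :=
  match u, v with
  | [::], [::] => true
  | a :: u', b :: v' => (if a then b else ~~ b) && eq_bits u' v'
  | _, _ => false
  end.

Fixpoint eq_code (g h : code) :=
  match g, h with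
  | [::], [::] => true
  | a :: g', b :: h' => eq_bits a b && eq_code g' h'
  | _, _ => false
  end.

Lemma eq_codeE g h : eq_code g h = (g == h).
Proof.
have bitsE u v : eq_bits u v = (u == v).
  by elim: u v => [|a u IHu] [|b v] //=; rewrite IHu eqseq_cons; case: a b => [] [].
by elim: g h => [|a g IHg] [|b h] //=; rewrite bitsE IHg eqseq_cons.
Qed.

Definition lookup A (g : code) (t : trie (code * A)) : option A :=
  if tfind (flatten g) t is Some (h, x) then
    if eq_code g h then Some x else None
  else None.

Definition store A (g : code) (x : A) t := tadd (flatten g) (g, x) t.

Lemma lookup_store A g h (x y : A) t :
  lookup g (store h x t) = Some y -> (g, y) = (h, x) \/ lookup g t = Some y.
Proof.
rewrite /lookup; case E: tfind => [[k z]|//].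
case: ifP => //; rewrite eq_codeE => /eqP gk [<-]; rewrite -{k}gk in E *.
by case: (tfind_tadd E) => [[-> ->]|->]; [left | right; rewrite eq_codeE eqxx].
Qed.

Definition found A (x : option A) : bool := if x is Some _ then true else false.

Fixpoint dedup (l : seq code) (t : trie (code * unit)) : seq code :=
  if l is g :: l' then
    if found (lookup g t) then dedup l' t else g :: dedup l' (store g tt t)
  else [::].

Lemma mem_dedup l t g : g \in l -> g \in dedup l t \/ found (lookup g t).
Proof.
elim: l t => //= h l IHl t; rewrite inE => /predU1P[->|/IHl gl].
  by case: ifP => ft; [right | left; rewrite mem_head].
case: ifP => _ //; rewrite inE; case: (gl (store h tt t)) => [->|].
  by left; rewrite orbT.
case E: lookup => [u|//] _; case: (lookup_store E) => [[-> _]|->]; last by right.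
by left; rewrite eqxx.
Qed.

Fixpoint level n : seq code :=
  if n is n'.+1 then
    dedup (flatten [seq [seq canon n (extend s g) | s <- all_bools n'] | g <- level n']) Tip
  else [:: [::]].

(** An isomorphism of [G - 0] with [H'] lifts to one of [G] with an extension of
[H'], by fixing the vertex 0. *)
Lemma iso_extend n (G : sgraph n.+1) (H' : sgraph n) : iso (del_vertex G ord0) H' ->
  exists2 H, iso G H & exists2 s, size s = n & code_of H = extend s (code_of H').
Proof.
case/isoP=> s sP.
pose f := lift_perm ord0 ord0 s^-1%g : 'S_n.+1.
exists (induced G f).
  rewrite [X in iso X _](_ : G = induced G id); last first.
    by apply: sgraphP => x y; rewrite adj_induced.
  by apply: iso_induced => [x y|i] //; exists (f^-1%g i); rewrite permKV.
exists [seq adj (induced G f) ord0 (lift ord0 j) | j <- enum 'I_n].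
  by rewrite size_map size_enum_ord.
rewrite /code_of /extend enum_ordSl /= adj_irr; congr ((_ :: _) :: _).
  by rewrite -[LHS]map_comp; apply: eq_map.
rewrite zip_map -[LHS]map_comp -[RHS]map_comp; apply: eq_map => i /=.
congr (_ :: _); first by rewrite adj_sym.
rewrite -[LHS]map_comp; apply: eq_map => j /=.
by rewrite adj_induced !lift_perm_lift -adj_del -sP !permKV.
Qed.

Lemma levelP n (G : sgraph n) : exists2 H, iso G H & code_of H \in level n.
Proof.
elim: n G => [|n IHn] G.
  exists G; first exact: iso_refl.
  by rewrite /code_of (size0nil (size_enum_ord 0)).
have [H' /iso_extend[H GH [s sn Hs]] H'n] := IHn (del_vertex G ord0).
have [I HI cI] := canonP H; exists I; first exact: iso_trans HI.
rewrite cI Hs /=; set l := flatten _; set g := canon _ _.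
have gl : g \in l.
  apply/flatten_mapP; exists (code_of H') => //.
  by apply: map_f; apply: mem_all_bools.
case: (mem_dedup Tip gl) => //; rewrite /lookup.
by case: (flatten g).
Qed.

(** * Integer polynomials *)

Section IntegerLists.
Local Open Scope Z_scope.

Fixpoint paddz (p q : seq Z) : seq Z :=
  match p, q with
  | [::], _ => q
  | _, [::] => p
  | a :: p', b :: q' => (a + b) :: paddz p' q'
  end.

Definition pscalez (c : Z) (p : seq Z) : seq Z := [seq c * a | a <- p].

Fixpoint pmulz (p q : seq Z) : seq Z :=
  if p is a :: p' then paddz (pscalez a q) (0 :: pmulz p' q) else [::].

Definition pevalz (p : seq Z) (x : Z) : Z := foldr (fun c r => c + x * r) 0 p.

Fixpoint peqz (p q : seq Z) : bool :=
  match p, q with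
  | [::], [::] => true
  | a :: p', b :: q' => Z.eqb a b && peqz p' q'
  | _, _ => false
  end.

Fixpoint dotz (u v : seq Z) : Z :=
  match u, v with
  | a :: u', b :: v' => a * b + dotz u' v'
  | _, _ => 0
  end.

Fixpoint dotb (s : seq bool) (v : seq Z) : Z :=
  match s, v with
  | true :: s', x :: v' => x + dotb s' v'
  | false :: s', _ :: v' => dotb s' v'
  | _, _ => 0
  end.

Fixpoint moments k (g : code) (s : seq bool) (v : seq Z) : seq Z :=
  if k is k'.+1 then dotb s v :: moments k' g s [seq dotb r v | r <- g] else [::].

Fixpoint tail_dots (p m : seq Z) : seq Z :=
  if p is _ :: p' then dotz p' m :: tail_dots p' m else [::].

(** The characteristic polynomial of the adjacency matrix [g] bordered by [s],
from that of [g]; see [char_poly_bordered]. *)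
Definition berkowitz n (g : code) (s : seq bool) (p : seq Z) : seq Z :=
  paddz (0 :: p) (pscalez (-1) (tail_dots p (moments n g s (map Z.b2z s)))).

Fixpoint charpolyz n (g : code) : seq Z :=
  if n is n'.+1 then
    let g' := map behead (behead g) in
    berkowitz n' g' (behead (head [::] g)) (charpolyz n' g')
  else [:: 1].

(** The polynomial whose roots are [w] times those of the monic polynomial [p].
With [w] a power of two, points on a fine grid become integers; with
[w = -1], this is the mirror image of [p]. *)
Definition scalez (w : Z) (p : seq Z) : seq Z :=
  (foldr (fun c (r : seq Z * Z) => (c * r.2 :: r.1, r.2 * w)) ([::], 1) p).1.

End IntegerLists.

Local Open Scope ring_scope.

Definition zC (z : Z) : algC := (int_of_Z z)%:~R.

Lemma zCD a b : zC (Z.add a b) = zC a + zC b.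
Proof. by rewrite /zC -intrD -rmorphD. Qed.

Lemma zCM a b : zC (Z.mul a b) = zC a * zC b.
Proof. by rewrite /zC -intrM -rmorphM. Qed.

Lemma zCN a : zC (Z.opp a) = - zC a.
Proof. by rewrite /zC -mulrNz -rmorphN. Qed.

Lemma zCB a b : zC (Z.sub a b) = zC a - zC b.
Proof. by rewrite -zCN -zCD. Qed.

Lemma zC_of_nat n : zC (Z.of_nat n) = n%:R.
Proof. by rewrite /zC -[Z.of_nat _]/(Z_of_int n) Z_of_intK. Qed.

Lemma zC_b2z (b : bool) : zC (Z.b2z b) = b%:R.
Proof. by case: b. Qed.

Lemma zC_norm a : zC (Z.abs a) = `|zC a|.
Proof. by rewrite /zC -intr_norm; congr _%:~R; lia. Qed.

Lemma zC_le a b : (zC a <= zC b) = Z.leb a b.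
Proof. by rewrite /zC ler_int; lia. Qed.

Lemma zC_lt a b : (zC a < zC b) = Z.ltb a b.
Proof. by rewrite /zC ltr_int; lia. Qed.

Lemma zC_eq a b : (zC a == zC b) = Z.eqb a b.
Proof. by rewrite /zC eqr_int; lia. Qed.

Lemma zC_real a : zC a \is Num.real.
Proof. exact: realz. Qed.

Lemma peqzP p q : reflect (p = q) (peqz p q).
Proof.
apply: (iffP idP) => [|<-]; last by elim: p => //= a p ->; rewrite Z.eqb_refl.
by elim: p q => [|a p IHp] [|b q] //= /andP[/Z.eqb_spec-> /IHp->].
Qed.

Definition polyz (p : seq Z) : {poly algC} := Poly (map zC p).

Lemma polyz_nil : polyz [::] = 0. Proof. by []. Qed.

Lemma polyz_cons a p : polyz (a :: p) = (zC a)%:P + 'X * polyz p.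
Proof. by rewrite /polyz /= cons_poly_def addrC mulrC. Qed.

Lemma coef_polyz p i : (polyz p)`_i = zC (nth 0 p i).
Proof.
rewrite coef_Poly; have [ip|ip] := ltnP i (size p); first by rewrite (nth_map 0).
by rewrite !nth_default ?size_map.
Qed.

Lemma polyzD p q : polyz (paddz p q) = polyz p + polyz q.
Proof.
elim: p q => [|a p IHp] [|b q] //=; rewrite ?polyz_nil ?add0r ?addr0 //.
by rewrite !polyz_cons IHp zCD polyCD mulrDr addrACA.
Qed.

Lemma polyzZ c p : polyz (pscalez c p) = (zC c) *: polyz p.
Proof.
elim: p => [|a p IHp]; first by rewrite scaler0.
by rewrite /= !polyz_cons IHp zCM scalerDr -scalerAr polyCM mul_polyC.
Qed.

Lemma polyzM p q : polyz (pmulz p q) = polyz p * polyz q.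
Proof.
elim: p => [|a p IHp]; first by rewrite polyz_nil mul0r.
by rewrite /= polyzD polyzZ !polyz_cons IHp mulrDl mul_polyC mulrA add0r.
Qed.

Lemma horner_polyz p x : zC (pevalz p x) = (polyz p).[zC x].
Proof.
elim: p => [|a p IHp]; first by rewrite horner0.
by rewrite /= polyz_cons zCD zCM IHp !hornerE.
Qed.

(** * Characteristic polynomials *)

Section BorderedMatrix.
Variables (R : idomainType) (n : nat) (A : 'M[R]_n) (b : 'rV[R]_n) (c : 'cV[R]_n).
Let phi := char_poly A.

(** The quotient of [phi(X) c - phi(A) c] by [X - A], in closed form. *)
Definition krylov : 'cV[{poly R}]_n :=
  \sum_(i < n.+1) (phi`_i)%:P *: \sum_(k < i)
     'X^(i.-1 - k) *: map_mx polyC (A ^+ k *m c).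

(** [X^i - A^i] is divisible by [X - A], and [phi(A) = 0] by Cayley-Hamilton. *)
Lemma krylovP : char_poly_mx A *m krylov = phi *: map_mx polyC c.
Proof.
rewrite /krylov /phi; case: n A c => [|n'] B d; first by rewrite !flatmx0.
have XM i : 'X^i%:M = 'X%:M ^+ i :> 'M[{poly R}]_n'.+1 by rewrite -rmorphXn.
have mapX k : map_mx polyC (B ^+ k) = map_mx polyC B ^+ k by rewrite -rmorphXn.
have X_B i : 'X^i%:M - map_mx polyC (B ^+ i) = char_poly_mx B *
    \sum_(k < i) 'X^(i.-1 - k) *: map_mx polyC (B ^+ k).
  rewrite mapX XM subrXX_comm; last exact: comm_scalar_mx.
  by congr (_ * _); apply: eq_bigr => k _; rewrite mapX -XM -mul_scalar_mx.
have size_phi : size (char_poly B) = n'.+2 by rewrite size_char_poly.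
have CH : \sum_(i < n'.+2) ((char_poly B)`_i)%:P *: map_mx polyC (B ^+ i) = 0.
  have := Cayley_Hamilton B; rewrite -{1}[char_poly B]coefK size_phi poly_def.
  rewrite rmorph_sum => /(congr1 (map_mx polyC)); rewrite map_mx0 raddf_sum => CHB.
  rewrite -[RHS]CHB; apply: eq_bigr => i _ /=.
  by rewrite horner_mxZ (rmorphXn (horner_mx B)) /= horner_mx_X map_mxZ.
transitivity ((\sum_(i < n'.+2) ((char_poly B)`_i)%:P *:
    ('X^i%:M - map_mx polyC (B ^+ i))) *m map_mx polyC d).
  rewrite mulmx_sumr mulmx_suml; apply: eq_bigr => i _.
  rewrite -scalemxAr -scalemxAl; congr (_ *: _); rewrite X_B -mulmxA mulmx_suml.
  by congr (_ *m _); apply: eq_bigr => k _; rewrite map_mxM scalemxAl.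
rewrite (eq_bigr _ (fun i _ => scalerBr _ _ _)) sumrB CH subr0 -mul_scalar_mx.
congr (_ *m _); rewrite -[char_poly B in RHS]coefK size_phi poly_def raddf_sum.
by apply: eq_bigr => i _; rewrite /= -mul_polyC scale_scalar_mx.
Qed.

(** Eliminating the border: the product of the bordered characteristic matrix
with a block triangular matrix of determinant [phi], whose first column is
[(phi, krylov)], is block upper triangular because of [krylovP]. This computes
the determinant times [phi], and [phi] can be cancelled since it is monic. *)
Lemma char_poly_bordered :
  char_poly (block_mx (0 : 'M_1) b c A) =
  'X * phi - \sum_(i < n.+1) \sum_(k < i)
     (phi`_i * (b *m (A ^+ k *m c)) 0 0) *: 'X^(i.-1 - k).
Proof.
have phi0 : phi != 0 by rewrite monic_neq0 ?char_poly_monic.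
set S := (X in _ - X).
have bk : map_mx polyC b *m krylov = S%:M.
  rewrite [LHS]mx11_scalar; congr _%:M; rewrite /krylov mulmx_sumr summxE.
  apply: eq_bigr => i _; rewrite -scalemxAr mxE mulmx_sumr summxE mulr_sumr.
  apply: eq_bigr => k _; rewrite -scalemxAr mxE -map_mxM mxE.
  by rewrite -mul_polyC polyCM mulrA mulrAC.
apply: (mulIf phi0).
rewrite {1}/char_poly /char_poly_mx map_block_mx scalar_mx_block opp_block_mx add_block_mx.
rewrite map_mx0 oppr0 addr0 !add0r.
have dB : \det (block_mx phi%:M 0 krylov (1%:M : 'M_n)) = phi.
  by rewrite det_lblock det_scalar1 det1 mulr1.
rewrite -[X in _ * X = _]dB -det_mulmx mulmx_block !mulmx1 !mulmx0 !add0r.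
rewrite (_ : - _ *m _ + _ = 0); last first.
  by rewrite mulNmx krylovP mul_mx_scalar addNr.
rewrite det_ublock /phi; congr (_ * _).
by rewrite mulNmx bk -scalar_mxM -raddfB /= det_scalar1.
Qed.

End BorderedMatrix.

Lemma exprS_mulmx (R : pzSemiRingType) n (A : 'M[R]_n) k (v : 'cV_n) :
  A ^+ k.+1 *m v = A ^+ k *m (A *m v).
Proof. by rewrite exprSr mulmxA. Qed.

Lemma size_code n (G : sgraph n) : size (code_of G) = n.
Proof. by rewrite size_map size_enum_ord. Qed.

Section CodeVectors.
Variables (n : nat) (G : sgraph n).

Definition colz (v : seq Z) : 'cV[algC]_n := \col_i zC (nth 0%R v i).

Lemma dotbE (s : seq bool) v : size s = n -> size v = n ->
  zC (dotb s v) = ((\row_j (nth false s j)%:R) *m colz v) 0 0.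
Proof.
move=> sn vn; rewrite mxE.
transitivity (\sum_(i < n) (nth false s i)%:R * zC (nth 0%R v i)); last first.
  by apply: eq_bigr => i _; rewrite !mxE.
elim: n s v sn vn => [|k IHk] [|b s] [|x v] //= => [|[sk] [vk]].
  by rewrite big_ord0.
by rewrite big_ord_recl -IHk //=; case: b; rewrite ?zCD ?mul1r // mul0r add0r.
Qed.

Lemma colz_map v : size v = n ->
  colz [seq dotb r v | r <- code_of G] = adj_mx G *m colz v.
Proof.
move=> vn; apply/colP => i; rewrite mxE (nth_map [::]); last first.
  by rewrite size_code.
rewrite dotbE //; last first.
  by rewrite /code_of (nth_map i) ?size_enum_ord // size_map size_enum_ord.
by rewrite !mxE; apply: eq_bigr => j _; rewrite !mxE nth_code.
Qed.

Lemma nth_moments k s v j : size s = n -> size v = n -> (j < k)%N ->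
  zC (nth 0%R (moments k (code_of G) s v) j) =
  ((\row_j (nth false s j)%:R) *m (adj_mx G ^+ j *m colz v)) 0 0.
Proof.
move=> sn; elim: k v j => // k IHk v [|j] vn jk /=.
  by rewrite dotbE // expr0 mul1mx.
rewrite IHk //; last by rewrite size_map size_code.
by rewrite (colz_map vn) exprS_mulmx.
Qed.

End CodeVectors.

Lemma dotzE n p m : size p = n ->
  zC (dotz p m) = \sum_(i < n) zC (nth 0%R p i) * zC (nth 0%R m i).
Proof.
move=> <-; elim: p m => [|a p IHp] [|b m] /=; rewrite ?big_ord0 //.
  by rewrite big1 // => i _; rewrite nth_nil mulr0.
by rewrite big_ord_recl zCD zCM IHp.
Qed.

(** Both sides satisfy the same recurrence when a constant coefficient is
prepended to [p]. *)
Lemma polyz_tail_dots n p m : size p = n ->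
  polyz (tail_dots p m) = \sum_(i < n) \sum_(j < i)
     (zC (nth 0%R p i) * zC (nth 0%R m j)) *: 'X^(i.-1 - j).
Proof.
move=> <-; elim: p => [|a p IHp] /=; first by rewrite big_ord0.
rewrite polyz_cons IHp (dotzE m (erefl _)) big_ord_recl big_ord0 add0r.
rewrite raddf_sum mulr_sumr -big_split; apply: eq_bigr => i _ /=.
rewrite big_ord_recr /= subnn expr0 alg_polyC addrC; congr (_ + _).
rewrite mulr_sumr; apply: eq_bigr => j _; rewrite -scalerAr -exprS.
by have -> : (i - j = (i.-1 - j).+1)%N by have := ltn_ord j; lia.
Qed.

Lemma size_paddz p q : size (paddz p q) = maxn (size p) (size q).
Proof.
elim: p q => [|a p IHp] [|b q] //=; rewrite ?max0n ?maxn0 //.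
by rewrite IHp maxnSS.
Qed.

Lemma size_tail_dots p m : size (tail_dots p m) = size p.
Proof. by elim: p => //= a p ->. Qed.

Lemma size_charpolyz n g : size (charpolyz n g) = n.+1.
Proof.
elim: n g => //= n IHn g.
rewrite /berkowitz size_paddz size_map size_tail_dots /= IHn.
exact/maxn_idPl.
Qed.

Lemma adj_mx_bordered n (G : sgraph n.+1) :
  let b := \row_j (adj G ord0 (lift ord0 j))%:R in
  adj_mx G = block_mx (0 : 'M_1) b b^T (adj_mx (del_vertex G ord0)) :> 'M_(1 + n).
Proof.
move=> b; rewrite -[LHS](@submxK _ 1 n 1 n).
congr block_mx; apply/matrixP => i j; rewrite !mxE.
- by rewrite !ord1 (_ : lshift n 0 = ord0) ?adj_irr //; apply: val_inj.
- by rewrite !ord1 rshift1 (_ : lshift n 0 = ord0) //; apply: val_inj.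
- rewrite !ord1 rshift1 adj_sym (_ : lshift n 0 = ord0) //; exact: val_inj.
- by rewrite !rshift1 adj_del.
Qed.

Theorem charpolyzP n (G : sgraph n) :
  polyz (charpolyz n (code_of G)) = char_poly (adj_mx G).
Proof.
elim: n G => [|n IHn] G; first by rewrite /char_poly det_mx00 polyz_cons mulr0 addr0.
rewrite /= -code_del0 /berkowitz polyzD polyzZ polyz_cons add0r IHn.
rewrite (adj_mx_bordered G) char_poly_bordered scaleN1r; congr (_ - _).
rewrite (polyz_tail_dots _ (size_charpolyz _ _)); apply: eq_bigr => i _.
apply: eq_bigr => j _; congr (_ * _ *: _); first by rewrite -coef_polyz IHn.
set s := behead _.
have sE : s = [seq adj G ord0 (lift ord0 j) | j <- enum 'I_n].
  by rewrite /s /code_of enum_ordSl /= -[LHS]map_comp.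
have sn : size s = n by rewrite sE size_map size_enum_ord.
rewrite nth_moments //; [|by rewrite size_map|]; last first.
  by have := ltn_ord i; have := ltn_ord j; lia.
have bE : \row_j (nth false s j)%:R = \row_j (adj G ord0 (lift ord0 j))%:R :> 'rV[algC]_n.
  by apply/rowP => k; rewrite !mxE sE (nth_map k) ?size_enum_ord ?nth_ord_enum.
rewrite bE; congr ((_ *m (_ *m _)) 0 0); apply/colP => k.
by rewrite !mxE (nth_map false) ?sn // zC_b2z sE (nth_map k) ?size_enum_ord ?nth_ord_enum.
Qed.

(** * Energy of a polynomial *)

Definition roots_of (p : {poly algC}) : seq algC := sval (closed_field_poly_normal p).

Lemma roots_ofP p : p \is monic -> p = \prod_(x <- roots_of p) ('X - x%:P).
Proof.
move=> /monicP p1; rewrite /roots_of.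
by case: closed_field_poly_normal => s /= {1}->; rewrite p1 scale1r.
Qed.

Definition poly_energy (p : {poly algC}) : algC := \sum_(x <- roots_of p) `|x|.

Lemma energyE n (G : sgraph n) : energy G = poly_energy (char_poly (adj_mx G)).
Proof. by []. Qed.

Lemma poly_energy_prod s :
  poly_energy (\prod_(x <- s) ('X - x%:P)) = \sum_(x <- s) `|x|.
Proof.
apply: perm_big; apply: prod_XsubC_eq.
by rewrite -roots_ofP // monic_prod_XsubC.
Qed.

Lemma poly_energyM p q : p \is monic -> q \is monic ->
  poly_energy (p * q) = poly_energy p + poly_energy q.
Proof.
move=> /roots_ofP-> /roots_ofP->.
by rewrite -big_cat !poly_energy_prod big_cat.
Qed.

Lemma poly_energy1 : poly_energy 1 = 0.
Proof. by have := poly_energy_prod [::]; rewrite !big_nil. Qed.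

(** The characteristic matrices are conjugate by a permutation matrix. *)
Lemma iso_char_poly n (G H : sgraph n) :
  iso G H -> char_poly (adj_mx G) = char_poly (adj_mx H).
Proof.
case/isoP=> s sP; pose M := char_poly_mx (adj_mx H).
rewrite /char_poly.
have -> : char_poly_mx (adj_mx G) = row_perm s (col_perm s M).
  by apply/matrixP => i j; rewrite !mxE sP (inj_eq perm_inj).
by rewrite row_permE col_permE !det_mulmx !det_perm mulrCA -signr_addb odd_permV addbb mulr1.
Qed.

Lemma iso_energy n (G H : sgraph n) : iso G H -> energy G = energy H.
Proof. by rewrite !energyE => /iso_char_poly->. Qed.

Lemma iso_local_energy n (G H : sgraph n) :
  iso G H -> local_energy G = local_energy H.
Proof.
case: n G H => [|n] G H GH; first by rewrite /local_energy !big_ord0.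
have [s sP] := isoP _ _ GH.
rewrite /local_energy [RHS](reindex_inj (@perm_inj _ s)) /=; apply: eq_bigr => v _.
congr (_ - _); first exact: iso_energy.
exact: iso_energy (iso_del v sP).
Qed.

(** Evaluate [v A v^*] in two ways, for a left eigenvector [v] of the real
symmetric matrix [A]. *)
Lemma adj_eigenvalue_real n (G : sgraph n) x :
  root (char_poly (adj_mx G)) x -> x \is Num.real.
Proof.
rewrite -eigenvalue_root_char => /eigenvalueP[v vA v0].
have AC : map_mx Num.conj (adj_mx G)^T = adj_mx G.
  by apply/matrixP => i j; rewrite !mxE adj_sym rmorph_nat.
pose w := map_mx Num.conj v^T.
have Aw : adj_mx G *m w = x^* *: w.
  by rewrite -{1}AC -map_mxM -trmx_mul vA linearZ map_mxZ.
have : x *: (v *m w) = x^* *: (v *m w).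
  by rewrite scalemxAl -vA -mulmxA Aw scalemxAr.
move/(congr1 (fun M : 'M_1 => M 0 0)); rewrite !mxE.
have vw : \sum_j v 0 j * w j 0 != 0.
  apply: contra v0; under eq_bigr => j _ do rewrite !mxE -normCK.
  rewrite psumr_eq0 => [|j _]; last by rewrite exprn_ge0.
  move=> /allP v0; apply/eqP/rowP => j; rewrite mxE; apply/eqP.
  by have := v0 j (mem_index_enum _); rewrite expf_eq0 normr_eq0.
by move/(mulIf vw)/esym/CrealP.
Qed.

(** * Enclosing energies *)

Section Brackets.
Local Open Scope Z_scope.

(** [|x| + x] rather than [|x|] is bounded on each interval: it is
nondecreasing, so that an interval for [x] gives one for [|x| + x], and it
vanishes for [x <= 0], so that only positive roots need precise intervals. The
sum of the roots, needed to return to [|x|], is read off a coefficient. *)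
Definition twice_pos (a : Z) : Z := Z.abs a + a.

(** Scans the increasing points [a :: pts], where [sa] is the sign of [p] at
[a], and returns the number of sign changes together with bounds for the sum of
[|x| + x] over one root per sign change. *)
Fixpoint brackets (p : seq Z) (a sa : Z) (pts : seq Z) : option (nat * Z * Z) :=
  if pts is b :: pts' then
    let sb := Z.sgn (pevalz p b) in
    if (Z.ltb a b, brackets p b sb pts') is (true, Some (k, l, h)) then
      if Z.ltb (sa * sb) 0 then Some (k.+1, twice_pos a + l, twice_pos b + h)
      else Some (k, l, h)
    else None
  else Some (0%N, 0, 0).

(** Bounds for [w] times the sum of [|x|] over the roots of [q], accepted only
if the sign changes account for all roots. Linear factors are treated exactly,
which keeps the rational eigenvalues out of the approximation. *)
Definition factor_bounds (w : Z) (f : seq Z * seq Z) : option (Z * Z) :=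
  let: (q, pts) := f in
  match q, pts with
  | [:: c; l], _ => if Z.eqb l 1 then Some (Z.abs c * w, Z.abs c * w) else None
  | [:: _, _, _ & _], a :: pts' =>
    let p := scalez w q in
    if brackets p a (Z.sgn (pevalz p a)) pts' is Some (k, l, h) then
      let t := nth 0 p k.-1 in
      if eqn (size q) k.+1 && Z.eqb (last 0 q) 1 then Some (l + t, h + t) else None
    else None
  | _, _ => None
  end.

Definition add_bounds (x y : option (Z * Z)) : option (Z * Z) :=
  if (x, y) is (Some (a, b), Some (c, d)) then Some (a + c, b + d) else None.

Definition product (fs : seq (seq Z)) : seq Z := foldr pmulz [:: 1] fs.

(** Factoring is needed because a root of even multiplicity causes no sign
change, hence multiple eigenvalues have to be separated into distinct
factors. *)
Definition energy_bounds (w : Z) n (g : code) (fs : seq (seq Z * seq Z)) : option (Z * Z) :=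
  if peqz (charpolyz n g) (product (map fst fs)) then
    foldr (fun f => add_bounds (factor_bounds w f)) (Some (0, 0)) fs
  else None.

End Brackets.

Lemma polyzK q : last 0 q = 1 -> polyseq (polyz q) = map zC q.
Proof.
move=> q1; apply: (@PolyK _ (zC 0)).
by rewrite last_map q1 oner_neq0.
Qed.

Lemma polyz_monic q : last 0 q = 1 -> polyz q \is monic.
Proof.
move=> q1; rewrite monicE lead_coefE polyzK // size_map (nth_map 0); last first.
  by case: q q1.
by rewrite nth_last q1.
Qed.

Lemma poly_energy_linear c : poly_energy (polyz [:: c; 1]) = `|zC c|.
Proof.
have -> : polyz [:: c; 1] = \prod_(x <- [:: - zC c]) ('X - x%:P).
  by rewrite big_seq1 !polyz_cons polyz_nil mulr0 addr0 mulr1 addrC polyCN opprK.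
by rewrite poly_energy_prod big_seq1 normrN.
Qed.

Lemma coef_prod_scaled (R : comNzRingType) (w : R) s i : (i <= size s)%N ->
  (\prod_(x <- s) ('X - (w * x)%:P))`_i =
  w ^+ (size s - i) * (\prod_(x <- s) ('X - x%:P))`_i.
Proof.
elim: s i => [|x s IHs] i si; first by rewrite !big_nil sub0n mul1r.
rewrite !big_cons !mulrBl !coefB !coefXM !coefCM /=.
case: i si => [_|i si] /=.
  by rewrite IHs // !subn0 !sub0r exprS mulrN mulrACA.
rewrite subSS (IHs i) // mulrBr; congr (_ - _).
move: si; rewrite ltnS leq_eqVlt => /predU1P[->|si].
  by rewrite !nth_default ?mulr0 // size_prod_XsubC.
by rewrite IHs // mulrACA -exprS subnSK.
Qed.

Lemma scalez_cons w c p :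
  scalez w (c :: p) = Z.mul c (w ^+ size p) :: scalez w p.
Proof.
rewrite /scalez /=; congr (Z.mul c _ :: _).
by elim: p => //= a p ->; rewrite exprSr.
Qed.

Lemma nth_scalez w p i :
  zC (nth 0 (scalez w p) i) = zC (nth 0 p i) * zC w ^+ ((size p).-1 - i).
Proof.
elim: p i => [|c p IHp] i; first by rewrite !nth_nil mul0r.
rewrite scalez_cons; case: i => [|i] /=.
  by rewrite zCM subn0 /zC !rmorphXn.
rewrite IHp; case: p {IHp} => [|a p]; first by rewrite !nth_nil !mul0r.
by rewrite subSS.
Qed.

Lemma polyz_scalez w q s : polyz q = \prod_(x <- s) ('X - x%:P) -> size q = (size s).+1 ->
  polyz (scalez w q) = \prod_(x <- s) ('X - (zC w * x)%:P).
Proof.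
move=> qs sq; apply/polyP => i; rewrite coef_polyz nth_scalez sq /=.
have [is_|si] := leqP i (size s); first by rewrite coef_prod_scaled // -qs coef_polyz mulrC.
by rewrite !nth_default ?mul0r ?sq // size_prod_XsubC.
Qed.

Lemma twice_pos_le (x y : algC) : x \is Num.real -> y \is Num.real -> x <= y ->
  `|x| + x <= `|y| + y.
Proof.
move=> xR yR; have [x0|x0] := real_ge0P xR; have [y0|y0] := real_ge0P yR => xy.
- by rewrite lerD.
- by have := le_lt_trans (le_trans x0 xy) y0; rewrite ltxx.
- by rewrite addNr addr_ge0.
- by rewrite !addNr.
Qed.

(** For a product of real linear factors the intermediate value property is
elementary: if no root lies strictly between [a] and [b], the factors
[(a - x) (b - x)] are all nonnegative. *)
Lemma root_between (s : seq algC) a b :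
  {in s, forall x, x \is Num.real} -> a \is Num.real -> b \is Num.real -> a < b ->
  (\prod_(x <- s) ('X - x%:P)).[a] * (\prod_(x <- s) ('X - x%:P)).[b] < 0 ->
  exists2 x, x \in s & a < x < b.
Proof.
move=> sR aR bR ab sgn_ab; apply/hasP; apply: contraLR sgn_ab => /hasPn no_root.
rewrite !horner_prod -big_split /= -real_leNgt ?rpred0 //; last first.
  rewrite big_seq; apply: rpred_prod => x xs; rewrite !hornerE.
  have xR := sR x xs; by apply: realM; apply: realB.
rewrite big_seq; apply: prodr_ge0 => x xs; rewrite !hornerE.
have xR := sR x xs; have := no_root x xs; rewrite negb_and -!real_leNgt //.
case/orP=> [xa|bx]; first by rewrite mulr_ge0 ?subr_ge0 // (le_trans xa) // ltW.
by rewrite mulr_le0 ?subr_le0 // ltW // (lt_le_trans ab).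
Qed.

Lemma bracketsP p s :
  polyz p = \prod_(x <- s) ('X - x%:P) -> {in s, forall x, x \is Num.real} ->
  forall pts a k l h, brackets p a (Z.sgn (pevalz p a)) pts = Some (k, l, h) ->
  exists t, [/\ uniq t, {subset t <= s}, {in t, forall x, zC a < x}, size t = k
    & zC l <= \sum_(x <- t) (`|x| + x) <= zC h].
Proof.
move=> ps sR; elim=> [|b pts IHpts] a k l h /=.
  by case=> <- <- <-; exists [::]; rewrite big_nil lexx.
case: ifP => // ab; case E: brackets => [[[k' l'] h']|] //.
have {E IHpts}[t [tU ts tb tk /andP[lt th]]] := IHpts _ _ _ _ E.
have {}ab : zC a < zC b by rewrite zC_lt.
case: ifP => [chg [<- <- <-] | _ [<- <- <-]]; last first.
  by exists t; rewrite lt th; split=> // x /tb; apply: lt_trans.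
have [|x xs /andP[ax xb]] := root_between sR (zC_real a) (zC_real b) ab.
  rewrite -ps -!horner_polyz -zCM -[ltRHS]/(zC 0) zC_lt.
  by move: chg; rewrite -Z.sgn_mul; lia.
exists (x :: t); split=> [|y|y||].
- by rewrite /= tU andbT; apply: contraTN xb => /tb bx; rewrite lt_gtF.
- by rewrite inE => /predU1P[->|/ts].
- by rewrite inE => /predU1P[->|/tb] //; apply: lt_trans.
- by rewrite /= tk.
have xR := sR x xs.
rewrite big_cons /twice_pos !zCD !zC_norm.
by apply/andP; split; apply: lerD => //; apply: twice_pos_le; rewrite ?zC_real ?ltW.
Qed.

(** The roots found by [bracketsP] are distinct and as many as the degree, so
they are all the roots. *)
Lemma factor_boundsP w f : (0 < zC w) ->
  {in roots_of (polyz f.1), forall x, x \is Num.real} ->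
  forall l h, factor_bounds w f = Some (l, h) ->
  polyz f.1 \is monic /\ zC l <= zC w * poly_energy (polyz f.1) <= zC h.
Proof.
case: f => q pts /= w0 qR l h.
case: q qR => [|c [|d [|e q]]] //= qR.
  case: Z.eqb_spec => // -> [<- <-]; split; first exact: polyz_monic.
  by rewrite poly_energy_linear zCM zC_norm mulrC lexx.
case: pts => // a pts; move: qR; set q' := [:: c, d, e & q] => qR.
case E: brackets => [[[k l'] h']|] //.
case: ifP => // /andP[/eqP sq /Z.eqb_spec q1] [<- <-].
have qm : polyz q' \is monic by exact: polyz_monic.
split=> //; have qs := roots_ofP qm; set s := roots_of _ in qR qs.
have ss : size s = k.
  have: size (polyz q') = k.+1 by rewrite polyzK // size_map -sq.
  by rewrite qs size_prod_XsubC => -[].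
have ps : polyz (scalez w q') = \prod_(y <- [seq zC w * x | x <- s]) ('X - y%:P).
  by rewrite big_map; apply: polyz_scalez => //; rewrite ss -sq.
have [|t [tU ts _ tk /andP[lt th]]] := bracketsP ps _ E.
  by move=> _ /mapP[x xs ->]; apply: realM; [apply: zC_real | apply: qR].
have {ts tU} tE : perm_eq t [seq zC w * x | x <- s].
  have sst : size [seq zC w * x | x <- s] = size t by rewrite size_map ss.
  have [|_ st] := uniq_min_size tU ts; first by rewrite sst.
  by apply: uniq_perm => //; rewrite (uniq_size_uniq tU st) sst.
have k0 : k = k.-1.+1 by rewrite -sq.
rewrite !zCD -(coef_polyz (scalez w q')) ps.
have -> : (\prod_(y <- [seq zC w * x | x <- s]) ('X - y%:P))`_k.-1 =
    - \sum_(y <- [seq zC w * x | x <- s]) y.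
  by rewrite -coefPn_prod_XsubC size_map ss // -sq.
rewrite qs poly_energy_prod mulr_sumr; move: lt th; rewrite (perm_big _ tE) big_split /=.
set S := \sum_(x <- _) x; rewrite big_map.
under eq_bigr => x _ do rewrite normrM (gtr0_norm w0).
by move=> lt th; rewrite lerBlDr lerBrDr lt th.
Qed.

Lemma root_roots_of p x : x \in roots_of p -> root p x.
Proof.
rewrite /roots_of; case: closed_field_poly_normal => s /= {1}-> xs.
by rewrite rootE hornerZ mulf_eq0 -rootE root_prod_XsubC xs orbT.
Qed.

Lemma polyz_product fs : polyz (product fs) = \prod_(f <- fs) polyz f.
Proof.
elim: fs => [|f fs IHfs] /=; last by rewrite big_cons polyzM IHfs.
by rewrite big_nil polyz_cons mulr0 addr0.
Qed.

Lemma energy_boundsP w n (G : sgraph n) fs l h : 0 < zC w ->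
  energy_bounds w n (code_of G) fs = Some (l, h) -> zC l <= zC w * energy G <= zC h.
Proof.
rewrite /energy_bounds => w0; case: peqzP => // chi.
have chiE : char_poly (adj_mx G) = \prod_(f <- fs) polyz f.1.
  by rewrite -charpolyzP chi polyz_product big_map.
have fsR : {in fs, forall f, {in roots_of (polyz f.1), forall x, x \is Num.real}}.
  move=> f ffs x /root_roots_of fx; apply: (@adj_eigenvalue_real _ G).
  by rewrite chiE (perm_big _ (perm_to_rem ffs)) big_cons rootM fx.
rewrite energyE chiE => {chi chiE G} fsb.
suff [] : \prod_(f <- fs) polyz f.1 \is monic /\
  zC l <= zC w * poly_energy (\prod_(f <- fs) polyz f.1) <= zC h by [].
elim: fs l h fsR fsb => [|f fs IHfs] l h fsR /=.
  by case=> <- <-; rewrite big_nil poly_energy1 mulr0 monic1 lexx.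
rewrite /add_bounds; case Ef: factor_bounds => [[lf hf]|//].
case Efs: foldr => [[l' h']|//] [<- <-].
have [|fm /andP[lfE hfE]] := factor_boundsP w0 _ Ef; first by apply: fsR; rewrite mem_head.
have [|fsm /andP[lE hE]] := IHfs _ _ _ Efs.
  by move=> g gfs; apply: fsR; rewrite inE gfs orbT.
rewrite big_cons; split; first by rewrite monicMl.
by rewrite poly_energyM // mulrDr !zCD !lerD.
Qed.

(** * Enclosing local energies *)

Section LocalBounds.
Local Open Scope Z_scope.

Definition entry := (code * seq (seq Z * seq Z))%type.

Definition energy_trie (w : Z) n (es : seq entry) : trie (code * (Z * Z)) :=
  foldr (fun e t => if energy_bounds w n e.1 e.2 is Some b then store e.1 b t else t)
    Tip es.

(** The canonical forms of the vertex-deleted subgraphs, whose energies are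
looked up among those of the representatives of order [n]. *)
Definition deck n (g : code) : seq code :=
  [seq canon n (reindex g (others n.+1 v)) | v <- iota 0 n.+1].

Definition local_bounds (w : Z) n (t : trie (code * (Z * Z))) (e : entry) : option (Z * Z) :=
  let deck_sum := foldr (fun g => add_bounds (lookup g t)) (Some (0, 0)) (deck n e.1) in
  if (energy_bounds w n.+1 e.1 e.2, deck_sum) is (Some (l, h), Some (l', h')) then
    let k := Z.of_nat n.+1 in Some (k * l - h', k * h - l')
  else None.

Definition join_bounds (x y : option (Z * Z)) : option (Z * Z) :=
  if (x, y) is (Some (l, h), Some (l', h')) then Some (Z.min l l', Z.max h h') else None.

Definition hull (bs : seq (option (Z * Z))) : option (Z * Z) :=
  if bs is b :: bs' then foldr join_bounds b bs' else None.

Fixpoint separated (x : Z) (bss : seq (seq (option (Z * Z)))) : bool :=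
  if bss is bs :: bss' then
    if hull bs is Some (l, h) then [&& Z.ltb x l, Z.leb l h & separated h bss'] else false
  else true.

End LocalBounds.

Lemma lookup_energy_trie w n es g b :
  lookup g (energy_trie w n es) = Some b -> exists fs, energy_bounds w n g fs = Some b.
Proof.
elim: es => [|e es IHes] /=; first by rewrite /lookup; case: (flatten g).
case E: energy_bounds => [b'|] //.
by move=> /(@lookup_store _ _ _ _ _ _)[[-> ->]|//]; exists e.2.
Qed.

Lemma local_energyE n (G : sgraph n.+1) :
  local_energy G = n.+1%:R * energy G - \sum_v energy (del_vertex G v).
Proof. by rewrite /local_energy sumrB sumr_const card_ord mulr_natl. Qed.

Lemma local_boundsP w n es (G : sgraph n.+1) e l h : 0 < zC w -> code_of G = e.1 ->
  local_bounds w n (energy_trie w n es) e = Some (l, h) ->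
  zC l <= zC w * local_energy G <= zC h.
Proof.
have kE := zC_of_nat n.+1.
move=> w0 Ge; rewrite /local_bounds -Ge; set t := energy_trie w n es.
move: (Z.of_nat n.+1) kE => k kE.
case E: energy_bounds => [[lG hG]|//]; case D: foldr => [[lD hD]|//] [<- <-].
have /andP[lGE hGE] := energy_boundsP w0 E.
have /andP[lDE hDE] : zC lD <= zC w * \sum_v energy (del_vertex G v) <= zC hD.
  move: D; rewrite /deck -val_enum_ord -[\sum_v _]big_enum /= -map_comp.
  elim: (enum _) lD hD => [|v vs IHvs] lD hD /=.
    by case=> <- <-; rewrite big_nil mulr0 lexx.
  rewrite {1}/add_bounds -code_del.
  case Ev: lookup => [[l1 h1]|//]; case Evs: foldr => [[l2 h2]|//] [<- <-].
  have /andP[le2 he2] := IHvs _ _ Evs.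
  have [fs] := lookup_energy_trie Ev.
  have [H GH <-] := canonP (del_vertex G v).
  case/(energy_boundsP w0)/andP=> le1 he1.
  by rewrite big_cons mulrDr !zCD (iso_energy GH) !lerD.
rewrite local_energyE mulrBr mulrCA !zCB !zCM kE.
by rewrite !lerB // ler_pM2l ?ltr0Sn.
Qed.

Lemma hullP bs l h : hull bs = Some (l, h) ->
  forall b, b \in bs -> exists l' h', [/\ b = Some (l', h'), zC l <= zC l' & zC h' <= zC h].
Proof.
case: bs => //= b0 bs; elim: bs l h => [|b bs IHbs] l h /=.
  by move=> -> c; rewrite inE => /eqP->; exists l, h; rewrite !lexx.
rewrite {1}/join_bounds; case: b => [[l1 h1]|//].
case E: foldr => [[l2 h2]|//] [<- <-] c; rewrite !inE.
have {E}IH := IHbs _ _ E; case/or3P=> [c0|/eqP->|cbs]; last 2 first.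
- by exists l1, h1; rewrite !zC_le; split=> //; lia.
- have [|l' [h' [-> ll hh]]] := IH c; first by rewrite inE cbs orbT.
  by exists l', h'; move: ll hh; rewrite !zC_le; split=> //; lia.
have [|l' [h' [-> ll hh]]] := IH c; first by rewrite inE c0.
by exists l', h'; move: ll hh; rewrite !zC_le; split=> //; lia.
Qed.

Definition in_group n (g : seq entry) (G : sgraph n) : Prop :=
  exists2 H, iso G H & code_of H \in map fst g.

Section Groups.
Variables (w : Z) (n : nat) (es : seq entry).
Hypothesis w0 : 0 < zC w.
Let bounds := local_bounds w n (energy_trie w n es).
Implicit Types (G H : sgraph n.+1) (g : seq entry).

Lemma hull_group g G l h : hull (map bounds g) = Some (l, h) -> in_group g G ->
  zC l <= zC w * local_energy G <= zC h.
Proof.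
move=> gb [H GH /mapP[e eg He]]; rewrite (iso_local_energy GH).
have [|l' [h' [eb ll hh]]] := hullP gb (b := bounds e); first exact: map_f.
have /andP[lH hH] := local_boundsP w0 He eb.
by rewrite (le_trans ll) // (le_trans hH).
Qed.

Lemma separated_gt x gs g G : separated x (map (map bounds) gs) -> g \in gs ->
  in_group g G -> zC x < zC w * local_energy G.
Proof.
elim: gs x => //= g1 gs IHgs x; case E: hull => [[l h]|//] /and3P[xl lh sep].
have {}xl : zC x < zC l by rewrite zC_lt.
rewrite inE => /predU1P[->|ggs] gG.
  by have /andP[lG _] := hull_group E gG; apply: lt_le_trans lG.
have {}lh : zC l <= zC h by rewrite zC_le.
exact: lt_trans (lt_le_trans xl lh) (IHgs _ sep ggs gG).
Qed.

(** Hulls at different positions of the list are disjoint, so equal local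
energies put two graphs in the same group. *)
Lemma separated_inj x gs g1 g2 G1 G2 : separated x (map (map bounds) gs) ->
  g1 \in gs -> g2 \in gs -> in_group g1 G1 -> in_group g2 G2 ->
  local_energy G1 = local_energy G2 -> g1 = g2.
Proof.
elim: gs x => //= g gs IHgs x; case E: hull => [[l h]|//] /and3P[_ _ sep].
rewrite !inE => /predU1P[->|g1s] /predU1P[->|g2s] // gG1 gG2 eG;
  last exact: IHgs sep _ _ _ _ _.
- have /andP[_ h1] := hull_group E gG1; have := separated_gt sep g2s gG2.
  by rewrite -eG => /lt_geF; rewrite h1.
- have /andP[_ h2] := hull_group E gG2; have := separated_gt sep g1s gG1.
  by rewrite eG => /lt_geF; rewrite h2.
Qed.

End Groups.

(** * Search for certificates *)

Section Search.
Local Open Scope Z_scope.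

(** The final intervals are a few dozen units wide, while the two closest
distinct local energies are about 112 units apart. *)
Definition resolution : Z := 2 ^ 24.

Fixpoint quotientz n (d p : seq Z) : seq Z :=
  if n is n'.+1 then
    let c := head 0 p in c :: quotientz n' d (behead (paddz p (pscalez (- c) d)))
  else [::].

Definition divide (d p : seq Z) : option (seq Z) :=
  let q := rev (quotientz ((size p).+1 - size d)%N (rev d) (rev p)) in
  if peqz (pmulz d q) p then Some q else None.

Fixpoint trial_division n (ds : seq (seq Z)) (p : seq Z) : seq (seq Z) :=
  match n, ds with
  | n'.+1, d :: ds' =>
    if divide d p is Some q then d :: trial_division n' ds q
    else trial_division n' ds' p
  | _, _ => if peqz p [:: 1] then [::] else [:: p]
  end.

(** All integers that occur as eigenvalues of graphs of order at most 7, and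
the irreducible polynomials of degree 2 or 3 that either occur with
multiplicity or are needed for the exact energies. Once these are divided out,
the remaining cofactor has simple irrational roots. *)
Definition small_factors : seq (seq Z) :=
  [seq [:: - z; 1] | z <- [:: 0; 1; 2; 3; 4; 5; 6; -1; -2; -3]] ++
  [:: [:: -1; 1; 1]; [:: -1; -1; 1]; [:: -2; 0; 1]; [:: -1; -2; 1; 1];
      [:: 1; -2; -1; 1]; [:: -1; -1; 2; 1]].

Definition factor (p : seq Z) : seq (seq Z) := trial_division 30 small_factors p.

Definition sign_at p x := Z.sgn (pevalz p x).

Fixpoint sign_changes p (pts : seq Z) : seq (Z * Z) :=
  if pts is a :: ((b :: _) as pts') then
    if Z.ltb (sign_at p a * sign_at p b) 0 then (a, b) :: sign_changes p pts'
    else sign_changes p pts'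
  else [::].

(** Adjacency eigenvalues of graphs of order at most 7 lie between -4 and 6. *)
Definition grid j : seq Z :=
  [seq resolution / 2 ^ Z.of_nat j * Z.of_nat i - 4 * resolution
  | i <- iota 0 (12 * 2 ^ j).+1].

Fixpoint isolate n j p : seq (Z * Z) :=
  let r := sign_changes p (grid j) in
  if n is n'.+1 then if eqn (size r).+1 (size p) then r else isolate n' j.+1 p else r.

Fixpoint bisect n p a b : Z * Z :=
  if n is n'.+1 then
    if Z.ltb (a + 1) b then
      let m := (a + b) / 2 in
      if Z.ltb (sign_at p a * sign_at p m) 0 then bisect n' p a m else bisect n' p m b
    else (a, b)
  else (a, b).

(** Of the intervals of negative roots the left endpoints suffice: the right
endpoint of each one has the same sign as the next point of the list, where 0
closes the last of them. *)
Definition sign_points (q : seq Z) : seq Z :=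
  if eqn (size q) 2 then [::] else
  let p := scalez resolution q in
  let r := isolate 8 1 p in
  [seq ab.1 | ab <- r & Z.leb ab.2 0] ++ 0 ::
  flatten [seq (let: (a, b) := bisect 30 p ab.1 ab.2 in [:: a; b])
          | ab <- r & Z.ltb 0 ab.2].

Definition certify n (g : code) : entry :=
  (g, [seq (q, sign_points q) | q <- factor (charpolyz n g)]).

Definition lower (x : option (Z * Z) * entry) := if x.1 is Some (l, _) then l else 0.
Definition upper (x : option (Z * Z) * entry) := if x.1 is Some (_, h) then h else 0.

Definition cluster (xs : seq (option (Z * Z) * entry)) :=
  foldr (fun x gs =>
    if gs is g :: gs' then
      if all (fun y => Z.ltb (upper x) (lower y)) g then [:: x] :: gs else (x :: g) :: gs'
    else [:: [:: x]]) [::] (sort (fun x y => Z.leb (lower x) (lower y)) xs).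

End Search.

Definition table6 : seq entry := Eval vm_compute in map (certify 6) (level 6).

Definition groups : seq (seq entry) := Eval vm_compute in
  let t := energy_trie resolution 6 table6 in
  let bounded e := (local_bounds resolution 6 t e, e) in
  map (map snd) (cluster [seq bounded (certify 7 g) | g <- level 7]).

Definition group_trie (gs : seq (seq entry)) : trie (code * unit) :=
  foldr (fun e t => store e.1 tt t) Tip (flatten gs).

Lemma levels_in_groups : all (fun g => found (lookup g (group_trie groups))) (level 7).
Proof. by vm_cast_no_check (erefl true). Qed.

Lemma groups_separated :
  separated (Zneg xH)
    (map (map (local_bounds resolution 6 (energy_trie resolution 6 table6))) groups).
Proof. by vm_cast_no_check (erefl true). Qed.

(** * Exact energies *)

Section ExactEnergies.
Local Open Scope Z_scope.

(** [x - 1], [x^2 - 2], [x^2 + x - 1] and [x^3 + x^2 - 2 x - 1]. The first has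
energy 1; the second comes from [P_3], the third from [C_5], and the fourth,
whose roots are [2 cos (2 k pi / 7)] for [k = 1, 2, 3], from [C_7]. *)
Definition basis : seq (seq Z) :=
  [:: [:: -1; 1]; [:: -2; 0; 1]; [:: -1; 1; 1]; [:: -1; -2; 1; 1]].

Definition unit_vector i (c : Z) : seq Z :=
  [seq if eqn i j then c else 0 | j <- iota 0 (size basis)].

Definition basis_vector (q : seq Z) : option (seq Z) :=
  let i := find (fun b => peqz q b || peqz (scalez (-1) q) b) basis in
  if (i < size basis)%N then Some (unit_vector i 1) else None.

(** The coordinates on [basis] of the energy of a factor. The energy of [x - k]
is [|k|], that is [|k|] times the energy of [x - 1]. *)
Definition factor_vector (q : seq Z) : option (seq Z) :=
  if Z.eqb (last 0 q) 1 then
    if q is [:: c; _] then Some (unit_vector 0 (Z.abs c)) else basis_vector q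
  else None.

Definition add_vectors (u v : option (seq Z)) : option (seq Z) :=
  if (u, v) is (Some u', Some v') then Some (paddz u' v') else None.

Definition energy_vector n (g : code) : option (seq Z) :=
  let p := charpolyz n g in
  let qs := factor p in
  if peqz p (product qs) then foldr (fun q => add_vectors (factor_vector q)) (Some [::]) qs
  else None.

Definition local_energy_vector n (g : code) : option (seq Z) :=
  let deck_sum := foldr (fun v => add_vectors
      (energy_vector n (reindex g (others n.+1 v)))) (Some [::]) (iota 0 n.+1) in
  if (energy_vector n.+1 g, deck_sum) is (Some u, Some v) then
    Some (paddz (pscalez (Z.of_nat n.+1) u) (pscalez (-1) v))
  else None.

End ExactEnergies.

(** [polyz u] serves only as a sequence of coefficients, which makes [value]
linear by the linearity of [polyz]. *)
Definition value (u : seq Z) : algC :=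
  \sum_(i < size basis) (polyz u)`_i * poly_energy (polyz (nth [::] basis i)).

Lemma valueD u v : value (paddz u v) = value u + value v.
Proof. by rewrite -big_split; apply: eq_bigr => i _; rewrite polyzD coefD mulrDl. Qed.

Lemma valueZ c u : value (pscalez c u) = zC c * value u.
Proof. by rewrite mulr_sumr; apply: eq_bigr => i _; rewrite polyzZ coefZ mulrA. Qed.

Lemma value0 : value [::] = 0.
Proof. by apply: big1 => i _; rewrite coef0 mul0r. Qed.

Lemma value_unit i c : (i < size basis)%N ->
  value (unit_vector i c) = zC c * poly_energy (polyz (nth [::] basis i)).
Proof.
move=> ib; rewrite /value (bigD1 (Ordinal ib)) //= big1 => [|j ji].
  by rewrite addr0 coef_polyz (nth_map 0%N) ?size_iota // nth_iota // eqnE eqxx.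
rewrite coef_polyz (nth_map 0%N) ?size_iota // nth_iota // add0n eqnE.
by case: eqP => [ij|_]; [case/eqP: ji; apply: val_inj | rewrite mul0r].
Qed.

Lemma poly_energy_mirror q : last 0 q = 1 ->
  poly_energy (polyz (scalez (-1)%R q)) = poly_energy (polyz q).
Proof.
move=> q1; have qs := roots_ofP (polyz_monic q1).
rewrite (polyz_scalez _ qs); last first.
  by rewrite -(size_prod_XsubC _ id) -qs polyzK // size_map.
rewrite -(big_map (fun x => zC (-1)%R * x) xpredT (fun y => 'X - y%:P)).
rewrite poly_energy_prod big_map {2}qs poly_energy_prod.
by apply: eq_bigr => x _; rewrite mulN1r normrN.
Qed.

Lemma basis_vectorP q u : last 0 q = 1 -> basis_vector q = Some u ->
  poly_energy (polyz q) = value u.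
Proof.
rewrite /basis_vector; set i := find _ _ => q1; case: ifP => // ib /Some_inj <-.
rewrite value_unit // -[zC _]/1 mul1r.
have: has (fun b => peqz q b || peqz (scalez (-1)%R q) b) basis by rewrite has_find.
move=> /(nth_find [::]); rewrite -/i => /orP[] /peqzP <- //.
by rewrite poly_energy_mirror.
Qed.

Lemma factor_vectorP q u : factor_vector q = Some u ->
  polyz q \is monic /\ poly_energy (polyz q) = value u.
Proof.
rewrite /factor_vector; case: Z.eqb_spec => // q1 qu; split; first exact: polyz_monic.
case: q q1 qu => [|c [|d [|e q]]] q1; try exact: basis_vectorP.
move: q1 => /= -> /Some_inj <-; rewrite value_unit // !poly_energy_linear.
by rewrite -zC_norm normrN1 mulr1.
Qed.

Lemma energy_vectorP n (G : sgraph n) u :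
  energy_vector n (code_of G) = Some u -> energy G = value u.
Proof.
rewrite /energy_vector; case: peqzP => // chi E.
rewrite energyE -charpolyzP chi polyz_product.
suff [] : \prod_(q <- factor (charpolyz n (code_of G))) polyz q \is monic /\
  poly_energy (\prod_(q <- factor (charpolyz n (code_of G))) polyz q) = value u by [].
elim: (factor _) u E => [|q qs IHqs] u /=.
  by case=> <-; rewrite big_nil poly_energy1 value0 monic1.
rewrite /add_vectors; case Eq: factor_vector => [v|//]; case Eqs: foldr => [v'|//] [<-].
have [qm qE] := factor_vectorP Eq; have [qsm qsE] := IHqs _ Eqs.
by rewrite big_cons monicMl // poly_energyM // qE qsE valueD.
Qed.

Lemma local_energy_vectorP n (G : sgraph n.+1) u :
  local_energy_vector n (code_of G) = Some u -> local_energy G = value u.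
Proof.
have kE := zC_of_nat n.+1.
rewrite /local_energy_vector; move: (Z.of_nat n.+1) kE => k kE.
case E: energy_vector => [v|//]; case D: foldr => [v'|//] [<-].
rewrite local_energyE valueD !valueZ kE mulN1r (energy_vectorP E); congr (_ - _).
move: D; rewrite -val_enum_ord -[\sum_v _]big_enum /=.
elim: (enum _) v' => [|x xs IHxs] v' /=; first by case=> <-; rewrite big_nil value0.
rewrite -code_del {1}/add_vectors.
case Ex: energy_vector => [a|//]; case Exs: foldr => [b|//] [<-].
by rewrite big_cons valueD (energy_vectorP Ex) (IHxs _ Exs).
Qed.

Close Scope ring_scope.

(** * The named graphs *)

Definition complete_nat (i j : nat) : bool := ~~ eqn i j.
Definition cycle_nat n (i j : nat) : bool :=
  ~~ eqn i j && (eqn (i.+1 %% n) j || eqn (j.+1 %% n) i).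
Definition path_nat (i j : nat) : bool := eqn i.+1 j || eqn j.+1 i.
Definition union_nat m (f g : rel nat) (i j : nat) : bool :=
  if i < m then (j < m) && f i j else (m <= j) && g (i - m) (j - m).

(** Adjacency in the named graphs is transported to natural numbers so that
their list-matrices can be evaluated. *)
Definition describes n (f : rel nat) (G : sgraph n) : Prop :=
  forall i j : 'I_n, adj G i j = f i j.

Lemma describes_K n : describes complete_nat (K_ n).
Proof. by move=> i j; rewrite adj_mk. Qed.

Lemma describes_C n : describes (cycle_nat n) (C_ n).
Proof. by move=> i j; rewrite adj_mk. Qed.

Lemma describes_P n : describes path_nat (P_ n).
Proof. by move=> i j; rewrite adj_mk. Qed.

Lemma describes_union m n f g (G : sgraph m) (H : sgraph n) :
  describes f G -> describes g H -> describes (union_nat m f g) (disj_union G H).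
Proof.
move=> fG gH i j; rewrite adj_mk /union_rel /union_nat.
case: splitP => a ->; case: splitP => b ->.
- exact: fG.
- by [].
- by rewrite leqNgt ltn_ord.
- by rewrite leq_addr !addKn gH.
Qed.

Definition code_of_rel n (f : rel nat) : code :=
  [seq [seq f i j | j <- iota 0 n] | i <- iota 0 n].

Lemma code_of_describes n f (G : sgraph n) : describes f G -> code_of G = code_of_rel n f.
Proof.
move=> fG; rewrite /code_of_rel -val_enum_ord -[RHS]map_comp; apply: eq_map => i /=.
by rewrite -[RHS]map_comp; apply: eq_map => j; apply: fG.
Qed.

Definition named : seq (seq (sgraph 7)) :=
  [:: [:: K_ 7; K_ 5 ∪ K_ 2; K_ 4 ∪ K_ 3; K_ 3 ∪ K_ 2 ∪ K_ 2; C_ 7; C_ 5 ∪ K_ 2]%G;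
      [:: K_ 6 ∪ K_ 1; K_ 4 ∪ K_ 2 ∪ K_ 1; K_ 3 ∪ K_ 3 ∪ K_ 1;
          K_ 2 ∪ K_ 2 ∪ K_ 2 ∪ K_ 1]%G;
      [:: K_ 5 ∪ K_ 1 ∪ K_ 1; K_ 3 ∪ K_ 2 ∪ K_ 1 ∪ K_ 1; C_ 5 ∪ K_ 1 ∪ K_ 1]%G;
      [:: K_ 4 ∪ K_ 1 ∪ K_ 1 ∪ K_ 1; K_ 2 ∪ K_ 2 ∪ K_ 1 ∪ K_ 1 ∪ K_ 1]%G;
      [:: K_ 4 ∪ P_ 3; K_ 2 ∪ K_ 2 ∪ P_ 3]%G].

Definition named_codes : seq (seq code) :=
  let K := complete_nat in let C := cycle_nat in let P := path_nat in
  let u := union_nat in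
  map (map (code_of_rel 7))
  [:: [:: K; u 5 K K; u 4 K K; u 5 (u 3 K K) K; C 7; u 5 (C 5) K];
      [:: u 6 K K; u 6 (u 4 K K) K; u 6 (u 3 K K) K; u 6 (u 4 (u 2 K K) K) K];
      [:: u 6 (u 5 K K) K; u 6 (u 5 (u 3 K K) K) K; u 6 (u 5 (C 5) K) K];
      [:: u 6 (u 5 (u 4 K K) K) K; u 6 (u 5 (u 4 (u 2 K K) K) K) K];
      [:: u 4 K P; u 4 (u 2 K K) P]].

Lemma named_codesE : map (map (@code_of 7)) named = named_codes.
Proof.
rewrite /named /named_codes [LHS]/= [RHS]/=.
do ?congr (_ :: _); apply: code_of_describes;
  do ?[exact: describes_K | exact: describes_C | exact: describes_P
      | apply: (@describes_union 6 1) | apply: (@describes_union 5 2)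
      | apply: (@describes_union 4 3) | apply: (@describes_union 5 1)
      | apply: (@describes_union 4 2) | apply: (@describes_union 3 3)
      | apply: (@describes_union 4 1) | apply: (@describes_union 3 2)
      | apply: (@describes_union 2 2)].
Qed.

Section NamedEnergies.
Local Open Scope Z_scope.

(** In the first family, the cubic polynomial of [basis] cancels out of the
local energy of [C_7]: with [e] its energy, [C_7] has energy [2 + 2 e], and
each of its seven vertex-deleted subgraphs is [P_6], of energy [2 e]. *)
Lemma named_local_energies :
  map (map (local_energy_vector 6)) named_codes =
  [:: nseq 6 (Some [:: 14; 0; 0; 0]); nseq 4 (Some [:: 12; 0; 0; 0]);
      nseq 3 (Some [:: 10; 0; 0; 0]); nseq 2 (Some [:: 8; 0; 0; 0]);
      nseq 2 (Some [:: 4; 3; 0; 0])].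
Proof. by vm_cast_no_check (erefl (map (map (local_energy_vector 6)) named_codes)). Qed.

End NamedEnergies.

Lemma named_charpolys_uniq : uniq (map (charpolyz 7) (flatten named_codes)).
Proof. by vm_cast_no_check (erefl true). Qed.

Definition named_canons : seq (seq code) := map (map (canon 7)) named_codes.

Lemma large_groups_named :
  all (fun g => eqn (size g) 1 ||
        has (fun cs => all (fun e => has (eq_code e.1) cs) g) named_canons) groups.
Proof. by vm_cast_no_check (erefl true). Qed.

Lemma named_codes_shape : uniq named_codes && all (fun cs => 1 < size cs) named_codes.
Proof. by vm_compute. Qed.

(** * The classes of order 7 *)

Lemma lookup_group_trie gs g : found (lookup g (group_trie gs)) ->
  exists2 g', g' \in gs & g \in map fst g'.
Proof.
rewrite /group_trie => gf.
suff [e /flattenP[g' gs' eg'] ->] : exists2 e, e \in flatten gs & g = e.1.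
  by exists g' => //; apply: map_f.
elim: (flatten gs) gf => [|e es IHes] /=; first by rewrite /lookup; case: (flatten g).
case E: lookup => [u|//] _; case: (lookup_store E) => [[-> _]|E'].
  by exists e; rewrite ?mem_head.
by have [|e' es' ->] := IHes; [rewrite E' | exists e'; rewrite // inE es' orbT].
Qed.

Lemma in_some_group (G : sgraph 7) : exists2 g, g \in groups & in_group g G.
Proof.
have [H GH H7] := levelP G.
have [g gs Hg] := lookup_group_trie (allP levels_in_groups _ H7).
exact: (ex_intro2 _ _ g gs (ex_intro2 _ _ H GH Hg)).
Qed.

Lemma same_group (G1 G2 : sgraph 7) g1 g2 : g1 \in groups -> g2 \in groups ->
  in_group g1 G1 -> in_group g2 G2 -> local_energy G1 = local_energy G2 -> g1 = g2.
Proof.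
have w0 : (0 < zC resolution)%R by rewrite -[ltLHS]/(zC 0%R) zC_lt.
exact: (@separated_inj resolution 6 table6 w0 _ groups g1 g2 G1 G2 groups_separated).
Qed.

Lemma named_code (ns : seq (sgraph 7)) : ns \in named -> map (@code_of 7) ns \in named_codes.
Proof. by move=> nsn; rewrite -named_codesE map_f. Qed.

Lemma named_energy ns (M N : sgraph 7) : ns \in named -> M \in ns -> N \in ns ->
  local_energy M = local_energy N.
Proof.
move=> /named_code nsn Mns Nns.
have [u uP] : exists u, {in map (@code_of 7) ns, forall g, local_energy_vector 6 g = Some u}.
  have: map (local_energy_vector 6) (map (@code_of 7) ns) \in
      map (map (local_energy_vector 6)) named_codes by apply: map_f.
  rewrite named_local_energies.
  have nseqP k u : map (local_energy_vector 6) (map (@code_of 7) ns) = nseq k (Some u) ->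
      exists u, {in map (@code_of 7) ns, forall g, local_energy_vector 6 g = Some u}.
    move=> nsE; exists u => g gns; apply/eqP.
    have: local_energy_vector 6 g \in nseq k (Some u) by rewrite -nsE map_f.
    by rewrite mem_nseq => /andP[].
  by rewrite !inE => /or4P[|||/orP[]] /eqP /nseqP.
rewrite (local_energy_vectorP (uP _ (map_f _ Mns))).
by rewrite (local_energy_vectorP (uP _ (map_f _ Nns))).
Qed.

Lemma uniq_flatten_mem (T : eqType) (ss : seq (seq T)) s1 s2 x :
  uniq (flatten ss) -> s1 \in ss -> s2 \in ss -> x \in s1 -> x \in s2 -> s1 = s2.
Proof.
elim: ss => //= s ss IHss; rewrite cat_uniq => /and3P[_ /hasPn dis ssU].
rewrite !inE => /predU1P[->|s1s] /predU1P[->|s2s] // x1 x2; last exact: IHss.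
- by have /negP[] := dis x (introT flattenP (ex_intro2 _ _ s2 s2s x2)).
- by have /negP[] := dis x (introT flattenP (ex_intro2 _ _ s1 s1s x1)).
Qed.

Lemma uniq_map_inj (T T' : eqType) (f : T -> T') s :
  uniq (map f s) -> {in s &, injective f}.
Proof.
elim: s => //= x s IHs /andP[/negP xs U] a b; rewrite !inE.
case/predU1P=> [->|sa] /predU1P[->|sb] // E; last exact: IHs.
- by case: xs; rewrite E map_f.
- by case: xs; rewrite -E map_f.
Qed.

Lemma iso_charpolyz n (G H : sgraph n) : iso G H ->
  charpolyz n (code_of G) = charpolyz n (code_of H).
Proof.
move=> /iso_char_poly; rewrite -!charpolyzP => GH.
apply: (@eq_from_nth _ 0%R); first by rewrite !size_charpolyz.
by move=> i _; apply/Z.eqb_spec; rewrite -zC_eq -!coef_polyz GH.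
Qed.

(** Characteristic polynomials distinguish all the named graphs, also across
families. *)
Lemma named_iso ns1 ns2 (M N : sgraph 7) : ns1 \in named -> ns2 \in named ->
  M \in ns1 -> N \in ns2 -> iso M N -> M = N /\ ns1 = ns2.
Proof.
move=> n1 n2 Mn Nn MN; have flatE : flatten named_codes = map (@code_of 7) (flatten named).
  by rewrite -named_codesE map_flatten.
have charU : uniq (map (fun G : sgraph 7 => charpolyz 7 (code_of G)) (flatten named)).
  by have := named_charpolys_uniq; rewrite flatE -map_comp.
have fM : M \in flatten named by apply/flattenP; exists ns1.
have fN : N \in flatten named by apply/flattenP; exists ns2.
have MNE : M = N by apply: (uniq_map_inj charU) => //; apply: iso_charpolyz.
by split=> //; apply: (uniq_flatten_mem (map_uniq charU) n1 n2 Mn); rewrite MNE.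
Qed.

Lemma code_of_inj n : injective (@code_of n).
Proof. by move=> G H GH; apply: sgraphP => i j; rewrite -!nth_code GH. Qed.

(** The dichotomy behind the classification: a group of one representative gives
no class, and every other group lies in a named family. *)
Lemma group_cases g : g \in groups -> size g = 1 \/
  exists2 ns, ns \in named & forall G, in_group g G -> exists2 N, N \in ns & iso G N.
Proof.
move=> gs; have [/eqP g1|] := orP (allP large_groups_named g gs); first by left.
case/hasP=> cs; rewrite /named_canons -named_codesE -map_comp => /mapP[ns nsn ->].
move=> /allP gcs; right; exists ns => // G [H GH /mapP[e eg He]].
have /hasP[c] := gcs e eg; rewrite eq_codeE => /mapP[d /mapP[N Nns ->] ->] /eqP eN.
have [H' NH' H'N] := canonP N; exists N => //.
have HH' : H = H' by apply: code_of_inj; rewrite H'N -eN.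
by apply: iso_trans GH _; rewrite HH'; apply: iso_sym.
Qed.

Lemma mem_classes n a (X : {set sgraph n}) :
  reflect (exists2 G, local_energy G = a & X = iso_class G)
    (X \in iso_classes_of_local_energy n a).
Proof.
apply: (iffP imsetP) => -[G]; first by rewrite inE => /eqP; exists G.
by move=> Ga ->; exists G; rewrite // inE Ga.
Qed.

(** All graphs with the local energy of [G] lie in the group of [G]. If this
group lies in a named family, then conversely the whole family has that local
energy. *)
Lemma classes_of_local_energy (G : sgraph 7) :
  let S := iso_classes_of_local_energy 7 (local_energy G) in
  #|S| <= 1 \/ exists2 ns, ns \in named & S = iso_classes_of ns.
Proof.
move=> S; have [g gs gG] := in_some_group G.
have Sg (H : sgraph 7) : local_energy H = local_energy G -> in_group g H.
  move=> HG; have [g' g's gH] := in_some_group H.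
  by rewrite -(same_group g's gs gH gG HG).
case: (group_cases gs) => [g1|[ns nsn gns]]; [left | right].
  rewrite -[X in _ <= X](cards1 (iso_class G)); apply/subset_leq_card/subsetP => X.
  case/mem_classes=> H /Sg gH ->; rewrite inE; apply/eqP/iso_class_eq.
  case: g g1 gG gH {gs Sg} => // e [] // _ [G' GG' /=].
  rewrite inE => /eqP Ge [H' HH']; rewrite inE -Ge => /eqP/code_of_inj H'G'.
  by apply: iso_trans HH' _; rewrite H'G'; apply: iso_sym.
exists ns => //; have [N0 N0ns GN0] := gns G gG.
apply/setP => X; apply/mem_classes/imsetP => [[H /Sg /gns[N Nns HN] ->] | [N Nns ->]].
  by exists N => //; apply/iso_class_eq.
by exists N => //; rewrite (named_energy nsn Nns N0ns) (iso_local_energy GN0).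
Qed.

Lemma uniq_of_flatten (T : eqType) (ss : seq (seq T)) s :
  uniq (flatten ss) -> s \in ss -> uniq s.
Proof.
elim: ss => //= s' ss IHss; rewrite cat_uniq inE => /and3P[s'U _ ssU].
by case/predU1P=> [->|/IHss->].
Qed.

Lemma named_pair ns : ns \in named ->
  exists M N : sgraph 7, [/\ M \in ns, N \in ns & ~~ iso M N].
Proof.
move=> nsn; have /andP[_ /allP/(_ _ (named_code nsn))] := named_codes_shape.
have charU : uniq (flatten (map (map (@code_of 7)) named)).
  by rewrite named_codesE; apply: map_uniq named_charpolys_uniq.
have := uniq_of_flatten charU (map_f _ nsn); case: ns nsn => [|M [|N ns]] //= nsn.
rewrite inE negb_or => /andP[/andP[MN _] _] _; exists M, N.
split; rewrite ?inE ?eqxx ?orbT //; apply: contra MN => MN.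
by have [|| -> _] := named_iso nsn nsn _ _ MN; rewrite ?inE ?eqxx ?orbT.
Qed.

Lemma named_classes_inj : {in named &, injective (@iso_classes_of 7)}.
Proof.
move=> ns1 ns2 n1 n2 E; have [M [_ [Mn _ _]]] := named_pair n1.
have: iso_class M \in iso_classes_of ns2 by rewrite -E; apply: imset_f.
by case/imsetP=> N Nn /iso_class_eq /(named_iso n1 n2 Mn Nn)[].
Qed.

Lemma equienergetic_classesE :
  equienergetic_classes 7 = [set S in map (@iso_classes_of 7) named].
Proof.
apply/setP => S; rewrite [LHS]inE [RHS]inE.
apply/andP/mapP => [[/imsetP[G _ ->] S1] | [ns nsn ->]].
  case: (classes_of_local_energy G) => [|[ns nsn SE]]; first by rewrite leqNgt S1.
  by exists ns.
have [M [N [Mn Nn /negP MN]]] := named_pair nsn.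
set S' := iso_classes_of_local_energy 7 (local_energy M).
have S'1 : 1 < #|S'|.
  have [MS NS] : iso_class M \in S' /\ iso_class N \in S'.
    by split; apply/mem_classes; [exists M | exists N; rewrite // (named_energy nsn Nn Mn)].
  rewrite (cardsD1 (iso_class M)) MS (cardsD1 (iso_class N)) !inE NS andbT.
  by case: eqP => // /esym/iso_class_eq.
have [|[ns' ns'n S'E]] := classes_of_local_energy M; first by rewrite leqNgt S'1.
have <- : S' = iso_classes_of ns; last by split=> //; apply: imset_f.
have: iso_class M \in S' by apply/mem_classes; exists M.
rewrite -/S' in S'E; rewrite S'E => /imsetP[N' N'n /iso_class_eq MN'].
by have [_ ->] := named_iso nsn ns'n Mn N'n MN'.
Qed.

Theorem proposition6 :
  #|equienergetic_classes 7| = 5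
  /\ equienergetic_classes 7 =
     [set iso_classes_of [:: K_ 7; K_ 5 ∪ K_ 2; K_ 4 ∪ K_ 3; K_ 3 ∪ K_ 2 ∪ K_ 2;
                             C_ 7; C_ 5 ∪ K_ 2]%G;
          iso_classes_of [:: K_ 6 ∪ K_ 1; K_ 4 ∪ K_ 2 ∪ K_ 1; K_ 3 ∪ K_ 3 ∪ K_ 1;
                             K_ 2 ∪ K_ 2 ∪ K_ 2 ∪ K_ 1]%G;
          iso_classes_of [:: K_ 5 ∪ K_ 1 ∪ K_ 1; K_ 3 ∪ K_ 2 ∪ K_ 1 ∪ K_ 1;
                             C_ 5 ∪ K_ 1 ∪ K_ 1]%G;
          iso_classes_of [:: K_ 4 ∪ K_ 1 ∪ K_ 1 ∪ K_ 1;
                             K_ 2 ∪ K_ 2 ∪ K_ 1 ∪ K_ 1 ∪ K_ 1]%G;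
          iso_classes_of [:: K_ 4 ∪ P_ 3; K_ 2 ∪ K_ 2 ∪ P_ 3]%G].
Proof.
rewrite equienergetic_classesE; split.
  have namedU : uniq named.
    have /andP[codesU _] := named_codes_shape.
    by apply: (@map_uniq _ _ (map (@code_of 7))); rewrite named_codesE.
  rewrite cardsE; have /card_uniqP -> : uniq (map (@iso_classes_of 7) named).
    by rewrite (map_inj_in_uniq named_classes_inj).
  by rewrite size_map.
rewrite /named !map_cons [map _ [::]]/=.
by apply/setP => S; rewrite [LHS]inE !in_cons in_nil orbF !inE -!orbA.
Qed.
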